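(* Let $\mathfrak g$ be a $2$-step solvable Lie algebra endowed with a complex structure $J$ and admitting an SKT metric compatible with $J$. Then $H^2(\mathfrak g,JU)=0$. As a consequence, $$\mathfrak g=\mathfrak{aff}(\mathbb R)^p\ltimes\mathrm{Rad}(\mathfrak g)$$ for some $p\ge 0$.
   Context: All Lie algebras are finite-dimensional and real. A complex structure on $\mathfrak g$ is $J\in\mathrm{End}(\mathfrak g)$ with $J^2=-\mathrm{Id}$ and $[X,Y]+J[JX,Y]+J[X,JY]-[JX,JY]=0$ for all $X,Y$; it is abelian if $[JX,JY]=[X,Y]$ for all $X,Y$. Write $\mathfrak g'=[\mathfrak g,\mathfrak g]$, $\mathfrak g'_J=\mathfrak g'\cap J\mathfrak g'$. $2$-step solvable means $[\mathfrak g',\mathfrak g']=0$. An SKT metric compatible with $J$ is an inner product $g$ on $\mathfrak g$ with $g(J\cdot,J\cdot)=g(\cdot,\cdot)$ such that $\omega=g(J\cdot,\cdot)$ satisfies $dd^c\omega=0$, with $d$ the Chevalley–Eilenberg differential and $d^c=J^{-1}dJ$. $\mathfrak g$ is $J$-solvable if the series $\mathfrak g^{[0]}(J)=\mathfrak g$, $\mathfrak g^{[j+1]}(J)=[\mathfrak g^{[j]}(J),\mathfrak g^{[j]}(J)]+J[\mathfrak g^{[j]}(J),\mathfrak g^{[j]}(J)]$ reaches $0$. $\mathrm{Rad}(\mathfrak g)$ is the maximal $J$-solvable ($J$-invariant) ideal. $\mathfrak g$ is $J$-semisimple if $\mathrm{Rad}(\mathfrak g)=0$. $\mathfrak{aff}(\mathbb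 R)=\langle X,JX\rangle$, $[JX,X]=X$; $\mathfrak{aff}(\mathbb C)=\langle X,JX,Y,JY\rangle$, $[JX,X]=X$, $[JX,Y]=[JY,X]=Y$, $[JY,Y]=-X$, $[X,Y]=[JX,JY]=0$. The notation $\mathfrak g=\mathfrak{aff}(\mathbb R)^p\ltimes\mathrm{Rad}(\mathfrak g)$ means that $\mathfrak g$ is the vector space direct sum of the ideal $\mathrm{Rad}(\mathfrak g)$ and a $J$-invariant subalgebra holomorphically isomorphic to the direct sum of $p$ copies of $\mathfrak{aff}(\mathbb R)$. Definition of $H^2(\mathfrak g,JU)$. Let $\mathcal O(\mathfrak g'_J)=\{X\in\mathfrak g: [\mathrm{ad}_X,J]|_{\mathfrak g'_J}=0\}$, a $J$-invariant ideal of $\mathfrak g$ containing $\mathfrak g'+J\mathfrak g'$, in which $\mathfrak g'_J$ is a $J$-invariant abelian ideal. The quotient $\mathfrak q=\mathcal O(\mathfrak g'_J)/\mathfrak g'_J$ has an abelian complex structure, hence a unique $J$-semisimple subalgebra $\mathfrak h$ with $\mathfrak q=\mathfrak h\ltimes\mathrm{Rad}(\mathfrak q)$. As a Lie algebra with complex structure, $\mathfrak h$ is a direct sum of ideals isomorphic to $\mathfrak{aff}(\mathbb R)$ or $\mathfrak{aff}(\mathbb C)$; let $s$ be the involution of $\mathfrak h$ equal to $-\mathrm{Id}$ on the vectors $Y,JY$ of the $\mathfrak{aff}(\mathbb C)$ summands and $\mathrm{Id}$ on the vectors $X,JX$ of all summands. With $B$ the Killing form of $\mathfrak h$, $B^{1,1}(V,W)=\frac12(B(V,W)+B(JV,JW))$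 and $B^{1,1}_s(V,W)=B^{1,1}(V,sW)$ (positive definite), the mean curvature vector $JU\in\mathfrak h$ is defined by $\mathrm{tr}(\mathrm{ad}^{\mathfrak h}_V)=B^{1,1}_s(JU,V)$ for all $V\in\mathfrak h$. Put $\mathfrak h_{JU}=\langle U,JU\rangle$ (a subalgebra of $\mathfrak h$) and let $\tau_{JU}:\mathfrak h_{JU}\to\mathrm{End}(\mathfrak g'_J)$ be the representation $X+\mathfrak g'_J\mapsto\mathrm{ad}_X|_{\mathfrak g'_J}$. Then $H^2(\mathfrak g,JU)$ is the second Lie algebra (Chevalley–Eilenberg) cohomology group $H^2(\mathfrak h_{JU},\tau_{JU})$ of $\mathfrak h_{JU}$ with values in $\tau_{JU}$. *)

(* Defs.v *)
From HB Require Import structures.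
From mathcomp Require Import all_boot all_order all_algebra.
From mathcomp Require Import reals.

Set Implicit Arguments.
Unset Strict Implicit.
Unset Printing Implicit Defensive.

Import Order.TTheory GRing.Theory Num.Theory.
Local Open Scope ring_scope.

(* Brackets are plain functions V -> V -> V, so that the same definitions apply
   to the given Lie algebra, to quotients and to subalgebras; bilinearity of
   the given bracket is carried by the type {bilinear V -> V -> V}.           *)

Section LieWithComplexStructure.
Variables (R : realType) (V : vectType R).
Variables (br : V -> V -> V) (J : 'End(V)).

Definition lie_bracket : Prop :=
  (forall x, br x x = 0) /\
  (forall x y z, br x (br y z) + br y (br z x) + br z (br x y) = 0).

Definition complex_structure : Prop :=
  (J \o J)%VF = - \1%VF /\
  (forall x y, br x y + J (br (J x) y) + J (br x (J y)) - br (J x) (J y) = 0).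

Definition brv (A B : {vspace V}) : {vspace V} :=
  <<[seq br x y | x <- vbasis A, y <- vbasis B]>>%VS.

Definition derv : {vspace V} := brv fullv fullv.

Definition derJ : {vspace V} := (derv :&: J @: derv)%VS.

Definition two_step_solvable : Prop := brv derv derv = 0%VS.

Definition J_derived (A : {vspace V}) : {vspace V} :=
  (brv A A + J @: brv A A)%VS.

Definition J_solvable (A : {vspace V}) : Prop :=
  exists k, iter k J_derived A = 0%VS.

Definition J_subalgebra (A : {vspace V}) : Prop :=
  (brv A A <= A)%VS /\ (J @: A <= A)%VS.

Definition J_ideal (L A : {vspace V}) : Prop :=
  [/\ (A <= L)%VS, (brv L A <= A)%VS & (J @: A <= A)%VS].

(* A = Rad(L), for L a J-invariant subalgebra *)
Definition is_Rad (L A : {vspace V}) : Prop :=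
  [/\ J_ideal L A, J_solvable A &
      forall B, J_ideal L B -> J_solvable B -> (B <= A)%VS].

Definition J_semisimple (L : {vspace V}) : Prop := is_Rad L 0%VS.

(* V = H |>< Rad(V) *)
Definition Rad_semidirect (H : {vspace V}) : Prop :=
  J_subalgebra H /\
  exists A, [/\ is_Rad fullv A, (H + A)%VS = fullv & (H :&: A)%VS = 0%VS].

(* the trace of the restriction of f to an f-invariant subspace A *)
Definition tr_on (A : {vspace V}) (f : V -> V) : R :=
  \sum_(i < \dim A) coord (vbasis A) i (f (vbasis A)`_i).

Definition killing (H : {vspace V}) (x y : V) : R :=
  tr_on H (fun z => br x (br y z)).

Definition killing11 (H : {vspace V}) (x y : V) : R :=
  2%:R^-1 * (killing H x y + killing H (J x) (J y)).

(* f is a holomorphic Lie isomorphism from (W, brW, JW) onto H *)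
Definition hol_iso (W : vectType R) (brW : W -> W -> W) (JW : W -> W)
    (H : {vspace V}) (f : 'Hom(W, V)) : Prop :=
  [/\ lker f = 0%VS, limg f = H,
      forall x y, f (brW x y) = br (f x) (f y) &
      forall x, f (JW x) = J (f x)].

Definition sub_br (H : {vspace V}) (x y : subvs_of H) : subvs_of H :=
  vsproj H (br (vsval x) (vsval y)).

End LieWithComplexStructure.

Section ChevalleyEilenberg.
Variables (R : realType) (L M : vectType R).
Variables (br : L -> L -> L) (rho : L -> M -> M).

Definition upd k (v : {ffun 'I_k -> L}) (i : 'I_k) (x : L) : {ffun 'I_k -> L} :=
  [ffun a => if a == i then x else v a].

Definition cochain k (c : {ffun 'I_k -> L} -> M) : Prop :=
  (forall (v : {ffun 'I_k -> L}) i a x y,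
     c (upd v i (a *: x + y)) = a *: c (upd v i x) + c (upd v i y)) /\
  (forall (v : {ffun 'I_k -> L}) i j, i != j -> v i = v j -> c v = 0).

(* The bracket term has [v_i, v_j] inserted at place i rather than moved to the
   front; this absorbs a factor (-1)^i of the usual sign (-1)^(i+j).          *)
Definition ce_d k (c : {ffun 'I_k -> L} -> M) (v : {ffun 'I_k.+1 -> L}) : M :=
  \sum_(i < k.+1) (-1) ^+ i *: rho (v i) (c [ffun a => v (lift i a)]) +
  \sum_(i < k.+1) \sum_(j < k.+1 | (i < j)%N)
     (-1) ^+ j *: c [ffun a => if lift j a == i then br (v i) (v j)
                               else v (lift j a)].

(* H^(k+1)(L, rho) = 0 *)
Definition ce_H_eq0 k : Prop :=
  forall c : {ffun 'I_k.+1 -> L} -> M,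
    cochain c -> (forall v, ce_d c v = 0) ->
    exists b : {ffun 'I_k -> L} -> M, cochain b /\ forall v, c v = ce_d b v.

End ChevalleyEilenberg.

Section SKT.
Variables (R : realType) (V : vectType R).
Variables (br : V -> V -> V) (J : 'End(V)).

Definition pull k (f : 'End(V)) (c : {ffun 'I_k -> V} -> R^o) :
    {ffun 'I_k -> V} -> R^o :=
  fun v => c [ffun a => f (v a)].

Definition d_form k (c : {ffun 'I_k -> V} -> R^o) : {ffun 'I_k.+1 -> V} -> R^o :=
  ce_d br (fun _ _ => 0) c.

Definition dc_form k (c : {ffun 'I_k -> V} -> R^o) : {ffun 'I_k.+1 -> V} -> R^o :=
  pull (J^-1)%VF (d_form (pull J c)).

Definition fundamental_form (g : V -> V -> R) : {ffun 'I_2 -> V} -> R^o :=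
  fun v => g (J (v ord0)) (v ord_max).

Definition SKT_metric (g : V -> V -> R) : Prop :=
  [/\ forall x y, g x y = g y x,
      forall x, x != 0 -> 0 < g x x,
      forall x y, g (J x) (J y) = g x y &
      forall v, d_form (dc_form (fundamental_form g)) v = 0].

End SKT.

Section AffineModels.
Variable R : realType.

(* (a, b) stands for a X + b JX *)
Definition affR : vectType R := (R^o * R^o)%type.

Definition aff_det (x y : affR) : R := x.2 * y.1 - x.1 * y.2.
Definition affR_br (x y : affR) : affR := (aff_det x y, 0).
Definition affR_J (x : affR) : affR := (- x.2, x.1).

(* ((a, b), (c, d)) stands for a X + b JX + c Y + d JY *)
Definition affC : vectType R := (affR * affR)%type.

Definition affC_br (x y : affC) : affC :=
  ((aff_det x.1 y.1 - aff_det x.2 y.2, 0),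
   (aff_det x.1 y.2 + aff_det x.2 y.1, 0)).
Definition affC_J (x : affC) : affC := (affR_J x.1, affR_J x.2).
Definition affC_s (x : affC) : affC := (x.1, - x.2).

Lemma affR_table (X : affR) : X = (1, 0) -> affR_br (affR_J X) X = X.
Proof.
by move=> ->; rewrite /affR_br /affR_J /aff_det /= oppr0 mulr1 mulr0 subr0.
Qed.

Lemma affC_table (X Y : affC) : X = ((1, 0), 0) -> Y = (0, (1, 0)) ->
  [/\ affC_br (affC_J X) X = X, affC_br (affC_J X) Y = Y,
      affC_br (affC_J Y) X = Y & affC_br (affC_J Y) Y = - X] /\
  affC_br X Y = 0 /\ affC_br (affC_J X) (affC_J Y) = 0.
Proof.
move=> -> ->; rewrite /affC_br /affC_J /affR_J /aff_det /=.
by split; [split|split]; congr (_, _); congr (_, _);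
   rewrite /= ?oppr0 ?(mulr0, mul0r, mulr1, subr0, sub0r, addr0, add0r, oppr0).
Qed.

Section DirectSums.
Variables p q : nat.

Definition affRs : vectType R := {ffun 'I_p -> affR}.
Definition affRs_br (x y : affRs) : affRs := [ffun i => affR_br (x i) (y i)].
Definition affRs_J (x : affRs) : affRs := [ffun i => affR_J (x i)].

(* aff(R)^p (+) aff(C)^q *)
Definition affs : vectType R := (affRs * {ffun 'I_q -> affC})%type.
Definition affs_br (x y : affs) : affs :=
  (affRs_br x.1 y.1, [ffun i => affC_br (x.2 i) (y.2 i)]).
Definition affs_J (x : affs) : affs :=
  (affRs_J x.1, [ffun i => affC_J (x.2 i)]).
Definition affs_s (x : affs) : affs := (x.1, [ffun i => affC_s (x.2 i)]).

End DirectSums.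
End AffineModels.

Section MeanCurvature.
Variables (R : realType) (V : vectType R).
Variables (br : V -> V -> V) (J : 'End(V)).

(* s is the involution of H fixing X, JX and changing the sign of Y, JY in each
   summand of a decomposition of H into copies of aff(R) and aff(C)           *)
Definition standard_involution (H : {vspace V}) (s : V -> V) : Prop :=
  exists (p q : nat) (f : 'Hom(affs R p q, V)),
    hol_iso br J (@affs_br R p q) (@affs_J R p q) H f /\
    forall x, s (f x) = f (affs_s x).

Definition is_mean_curvature (H : {vspace V}) (JU : V) : Prop :=
  JU \in H /\
  exists2 s : V -> V, standard_involution H s &
    forall x, x \in H -> tr_on H (br x) = killing11 br J H JU (s x).

End MeanCurvature.

Section SecondCohomology.
Variables (R : realType) (V : vectType R).
Variables (br : V -> V -> V) (J : 'End(V)).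

(* X |-> [ad_X, J] restricted to g'_J, extended by zero on a complement *)
Definition adJ_on_derJ (x : V) : 'End(V) :=
  (((linfun (br x) \o J) - (J \o linfun (br x))) \o projv (derJ br J))%VF.

Definition OJ : {vspace V} := lker (linfun adJ_on_derJ).

(* O(g'_J) / g'_J, carried by a complement of g'_J in O(g'_J) *)
Definition quoJ : vectType R := subvs_of (OJ :\: derJ br J)%VS.

Definition quo_pi : 'Hom(V, quoJ) :=
  (linfun (vsproj (OJ :\: derJ br J)) \o addv_pi1 OJ (derJ br J))%VF.

Definition quo_br (x y : quoJ) : quoJ := quo_pi (br (vsval x) (vsval y)).

Definition quo_J : 'End(quoJ) := (quo_pi \o J \o linfun vsval)%VF.

(* h is the J-semisimple factor of the quotient *)
Definition quo_factor (h : {vspace quoJ}) : Prop :=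
  J_semisimple quo_br quo_J h /\ Rad_semidirect quo_br quo_J h.

Section Cohomology.
Variable JU : quoJ.

(* U = - J(JU) *)
Definition h_JU : {vspace quoJ} := <<[:: - quo_J JU; JU]>>%VS.

Definition tau_JU (x : subvs_of h_JU) (m : subvs_of (derJ br J)) :
    subvs_of (derJ br J) :=
  vsproj (derJ br J) (br (vsval (vsval x)) (vsval m)).

Definition H2_JU_eq0 : Prop :=
  ce_H_eq0 (@sub_br R quoJ quo_br h_JU) tau_JU 1.

End Cohomology.
End SecondCohomology.

Section Checks.
Variables (R : realType) (V : vectType R).
Variables (br : {bilinear V -> V -> V}) (J : 'End(V)).

Let adJE x z (y := projv (derJ br J) z) :
  adJ_on_derJ br J x z = br x (J y) - J (br x y).
Proof.
by rewrite /adJ_on_derJ comp_lfunE add_lfunE opp_lfunE !comp_lfunE !lfunE.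
Qed.

Let adJ_linear : linear (adJ_on_derJ br J).
Proof.
move=> a x y; apply/lfunP=> z; rewrite add_lfunE scale_lfunE !adJE.
by rewrite !linearPl linearP /= scalerBr opprD addrACA.
Qed.

#[local] HB.instance Definition _ :=
  GRing.isLinear.Build R V 'End(V) _ (adJ_on_derJ br J) adJ_linear.

Lemma mem_OJ x :
  x \in OJ br J <->
  (forall y, y \in derJ br J -> br x (J y) = J (br x y)).
Proof.
rewrite memv_ker lfunE; split=> [/eqP/lfunP h y yJ | h].
  by have /eqP := h y; rewrite adJE zero_lfunE projv_id // subr_eq0 => /eqP.
by apply/eqP/lfunP=> y; rewrite zero_lfunE adJE h ?memv_proj // subrr.
Qed.

Lemma quo_piP x :
  x \in OJ br J -> x - vsval (quo_pi br J x) \in derJ br J.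
Proof.
move=> xO; rewrite /quo_pi comp_lfunE lfunE /= vsprojK; last exact: memv_pi.
rewrite -{1}(@addv_pi1_pi2 _ _ (OJ br J) (derJ br J) x); last first.
  exact: (subvP (addvSl _ _)).
by rewrite addrC addKr memv_pi2.
Qed.

End Checks.

(* Main.v *)
(* Write a = g', k = g'_J, and x ** y = [Jx, y].  As a is abelian, ad(g) acts on
   a by commuting operators, and ** makes a/k a commutative associative algebra;
   ** vanishes on k x a, and a x k goes to k.
   Evaluating dd^c w on (Je, e, z, Jz), where e ** e = e mod k and z in k is an
   eigenvector e ** z = z, gives -6 |z|^2 = 0.  So e ** - id is invertible on k;
   for e = U/2 this is the vanishing of H^2, because U acts trivially on g'_J.
   It also lifts idempotents, and eigenvectors of idempotents for the eigenvalue
   1, from a/k to a.  For such a lift e and e ** y = y, dd^c w (Je, Jy, e, y) = 0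
   gives g(y ** y, e) = |y|^2.  Hence the unital ideals of a/k are formally real,
   and an ideal of a/k that is not nilpotent contains an idempotent e whose ideal
   is the line R e.  A maximal orthogonal family of such e spans with its image
   under J the factor aff(R)^p; the common kernel of the weights of g on the e's
   and of their composites with J is Rad(g). *)
Require Import Defs.
From HB Require Import structures.
From mathcomp Require Import all_boot all_order all_algebra.
From mathcomp Require Import boolp reals.
From mathcomp Require Import complex ring lra.

Set Implicit Arguments.
Unset Strict Implicit.
Unset Printing Implicit Defensive.

Import Order.TTheory GRing.Theory Num.Theory.
Local Open Scope ring_scope.

(** * Subspaces and endomorphisms *)

Section LinearAlgebra.
Variables (R : realType) (V : vectType R).
Implicit Types (U W X : {vspace V}) (f : 'End(V)).

(** A strict inclusion lowers the dimension, so the induction bounds the dimension of the first term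
    and shifts the chain by one. *)
Lemma vspace_descending_stable (U : nat -> {vspace V}) :
  (forall j, (U j.+1 <= U j)%VS) -> exists j, U j.+1 = U j.
Proof.
move=> Ud; have [n leUn] := ubnP (\dim (U 0%N)).
elim: n U Ud leUn => // n IHn U Ud leUn.
have [/eqP|neqU] := boolP (U 1%N == U 0%N); first by exists 0%N.
have [||j] := IHn (fun j => U j.+1); last by exists j.+1.
  by move=> j; exact: Ud.
rewrite -ltnS (leq_trans _ leUn) // ltnS ltn_neqAle.
rewrite dimvS ?Ud // andbT.
by apply: contraNneq neqU => eqd; rewrite eqEdim Ud eqd /=.
Qed.

Lemma sub_limgP f U W :
  reflect (forall x, x \in U -> f x \in W) (f @: U <= W)%VS.
Proof.
apply: (iffP subvP) => [fUW x xU|fUW _ /memv_imgP[x xU ->]]; last exact: fUW.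
exact/fUW/memv_img.
Qed.

Lemma limg_eq_inj f U x : (f @: U = U)%VS -> x \in U -> f x = 0 -> x = 0.
Proof.
move=> fU xU fx0; apply/eqP; rewrite -memv0.
suff <- : (U :&: lker f = 0)%VS by rewrite memv_cap xU memv_ker fx0 eqxx.
apply/eqP; rewrite -dimv_eq0 -(eqn_add2r (\dim (f @: U))) limg_ker_dim fU.
by rewrite add0n.
Qed.

Lemma inj_limg_eq f U : (forall x, x \in U -> f x \in U) ->
  (forall x, x \in U -> f x = 0 -> x = 0) -> (f @: U = U)%VS.
Proof.
move=> fU f0; apply/eqP; rewrite eqEdim (introT (sub_limgP _ _ _) fU) /=.
rewrite limg_dim_eq //; apply/eqP; rewrite -subv0; apply/subvP => x.
by rewrite memv_cap memv_ker memv0 => /andP[xU /eqP/(f0 _ xU)->].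
Qed.

Section Brv.
Variable br : {bilinear V -> V -> V}.

Lemma memv_brv U W x y : x \in U -> y \in W -> br x y \in brv br U W.
Proof.
move=> xU yW; rewrite (coord_vbasis xU) (coord_vbasis yW) linear_sumlz /=.
apply: memv_suml => i _; rewrite linear_sumr; apply: memv_suml => j _.
rewrite linearZl_LR linearZr_LR /=; do 2 apply: memvZ.
by apply: memv_span; apply: allpairs_f; apply: memt_nth.
Qed.

Lemma brv_subP U W X :
  reflect (forall x y, x \in U -> y \in W -> br x y \in X) (brv br U W <= X)%VS.
Proof.
apply: (iffP idP) => [/subvP sX x y xU yW|h]; first exact/sX/memv_brv.
apply/span_subvP => _ /allpairsP[[x y] [/= /vbasis_mem xU /vbasis_mem yW ->]].
exact: h.
Qed.

Lemma brvS U1 U2 W1 W2 :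
  (U1 <= U2)%VS -> (W1 <= W2)%VS -> (brv br U1 W1 <= brv br U2 W2)%VS.
Proof.
move=> /subvP sU /subvP sW; apply/brv_subP => x y xU yW.
by apply: memv_brv; [exact: sU|exact: sW].
Qed.

End Brv.

(** The pair [u], [w] is the real and imaginary part of an eigenvector of the complexification, for
    the eigenvalue [a + ib]. *)
Lemma complex_eigenvector f U : U != 0%VS -> (f @: U <= U)%VS ->
  exists a b u w, [/\ u \in U, w \in U, (u != 0) || (w != 0),
    f u = a *: u - b *: w & f w = b *: u + a *: w].
Proof.
move=> U0 /sub_limgP fU.
set n := \dim U; set B := vbasis U.
pose M : 'M[R]_n := \matrix_(i, j) coord B j (f B`_i).
have n0 : (0 < n)%N by rewrite lt0n dimv_eq0.
have fB (i : 'I_n) : f B`_i = \sum_j M i j *: B`_j.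
  rewrite {1}(@coord_vbasis _ _ (f B`_i) U); last first.
    by apply/fU/vbasis_mem/memt_nth.
  by apply: eq_bigr => j _; rewrite mxE.
have [l /eigenvalueP[v vM v0]] :=
  eigenvalue_closed (map_mx (real_complex R) M) n0.
pose comb (c : R[i] -> R) := \sum_i c (v 0 i) *: B`_i.
have combU c : comb c \in U.
  by apply: memv_suml => i _; apply/memvZ/vbasis_mem/memt_nth.
(* A real-linear [c], later [Re] or [Im], is applied to the coordinates of the equation for the row
   eigenvector. *)
have fcomb (c : {additive R[i] -> R}) :
    (forall x (y : R), c (x * y%:C)%C = c x * y) ->
    f (comb c) = \sum_j c (l * v 0 j) *: B`_j.
  move=> cM; rewrite linear_sum /=.
  under eq_bigr => i _ do rewrite linearZ /= fB scaler_sumr.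
  rewrite exchange_big /=; apply: eq_bigr => j _.
  under eq_bigr => i _ do rewrite scalerA -cM.
  rewrite -scaler_suml -raddf_sum; congr (c _ *: _).
  have /matrixP/(_ 0 j) := vM; rewrite !mxE => <-.
  by apply: eq_bigr => i _; rewrite !mxE.
exists (complex.Re l), (complex.Im l).
exists (comb (@complex.Re R)), (comb (@complex.Im R)).
split; rewrite ?combU //.
- apply: contraNT v0; rewrite negb_or !negbK => /andP[/eqP u0 /eqP w0].
  have /freeP freeB := basis_free (vbasisP U).
  apply/eqP/rowP => i; rewrite mxE; apply/eqP; rewrite eq_complex.
  by rewrite (freeB _ u0 i) (freeB _ w0 i) /= eqxx.
- rewrite (fcomb (@complex.Re R)).
  + rewrite !scaler_sumr -sumrB; apply: eq_bigr => j _.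
    by rewrite !scalerA -scalerBl; case: (l) (v 0 j) => ? ? [].
  + by case=> x1 x2 y /=; rewrite mulr0 subr0.
- rewrite (fcomb (@complex.Im R)).
  + rewrite !scaler_sumr -big_split; apply: eq_bigr => j _ /=.
    rewrite !scalerA -scalerDl; congr (_ *: _).
    by case: (l) (v 0 j) => ? ? [? ?] /=; rewrite addrC.
  + by case=> x1 x2 y /=; rewrite mulr0 add0r.
Qed.

End LinearAlgebra.

(** * Idempotents in formally real commutative algebras *)

Section CommutativeAlgebra.
Variables (R : realType) (A : vectType R) (m : {bilinear A -> A -> A}).
Hypothesis mC : forall x y, m x y = m y x.
Hypothesis mA : forall x y z, m x (m y z) = m (m x y) z.

Let mCA x y z : m x (m y z) = m y (m x z).
Proof. by rewrite mA (mC x) -mA. Qed.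

Let linmE x y : linfun (m x) y = m x y. Proof. by rewrite lfunE. Qed.

Definition alg_ideal (I : {vspace A}) : Prop :=
  forall x y, y \in I -> m x y \in I.

Lemma alg_ideal_limg (I : {vspace A}) x :
  alg_ideal I -> alg_ideal (linfun (m x) @: I)%VS.
Proof.
move=> Iid z _ /memv_imgP[y yI ->]; rewrite linmE mCA -linmE.
exact/memv_img/Iid.
Qed.

Lemma alg_ideal_brv (I : {vspace A}) : alg_ideal I -> alg_ideal (brv m I I).
Proof.
move=> Iid z y yII.
rewrite -linmE; apply: (elimT (sub_limgP _ _ _) _ y yII).
rewrite limg_span; apply/span_subvP => _ /mapP[_ /allpairsP[[u v] /=
  [/vbasis_mem uI /vbasis_mem vI ->]] ->]; rewrite linmE mA.
exact/memv_brv/vI/Iid.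
Qed.

(** For an ideal [I] these ideals descend to the Fitting component of [x], on which multiplication
    by [x] is onto and so bijective. *)
Definition mul_iter (I : {vspace A}) x j : {vspace A} :=
  iter j (fun U : {vspace A} => linfun (m x) @: U)%VS I.

Lemma mul_iter_ideal I x j : alg_ideal I -> alg_ideal (mul_iter I x j).
Proof. by move=> Iid; elim: j => //= j; exact: alg_ideal_limg. Qed.

Lemma mul_iterS I x j : alg_ideal I -> (mul_iter I x j.+1 <= mul_iter I x j)%VS.
Proof.
move=> Iid; apply/sub_limgP => y yj; rewrite linmE.
exact: mul_iter_ideal.
Qed.

Lemma mul_iter_sub I x j : alg_ideal I -> (mul_iter I x j <= I)%VS.
Proof.
move=> Iid; elim: j => // j IHj.
by apply: subv_trans IHj; apply: mul_iterS.
Qed.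

Lemma mul_iter_stable I x : alg_ideal I ->
  exists j, (linfun (m x) @: mul_iter I x j = mul_iter I x j)%VS.
Proof.
move=> Iid; apply: (@vspace_descending_stable _ _ (mul_iter I x)) => j.
exact: mul_iterS.
Qed.

Lemma iter_stable I x j : (linfun (m x) @: I)%VS = I -> mul_iter I x j = I.
Proof. by move=> xI; elim: j => //= j ->. Qed.

Lemma mem_mul_iter (I : {vspace A}) x j y :
  y \in I -> iter j (m x) y \in mul_iter I x j.
Proof. by move=> yI; elim: j => //= j; rewrite -linmE; exact: memv_img. Qed.

(** Two factors [x] split over a product as [x(x(uv)) = (xu)(xv)]. Hence the stable term of the
    chain of an idempotent ideal is again idempotent. *)
Lemma mul_iter_brv I x j :
  (mul_iter (mul_iter (brv m I I) x j) x j <=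
   brv m (mul_iter I x j) (mul_iter I x j))%VS.
Proof.
elim: j => //= j IHj; rewrite -/(mul_iter _ _ _) -/(mul_iter _ _ _).
have -> (U : {vspace A}) :
    (linfun (m x) @: mul_iter (linfun (m x) @: U) x j =
     linfun (m x) @: (linfun (m x) @: mul_iter U x j))%VS.
  by rewrite /mul_iter -iterSr.
apply: subv_trans (limgS _ (limgS _ IHj)) _.
rewrite -limg_comp limg_span; apply/span_subvP => _ /mapP[_ /allpairsP[[u v] /=
  [/vbasis_mem uI /vbasis_mem vI ->]] ->]; rewrite comp_lfunE !linmE.
rewrite (mCA x u) mA -[m x u]linmE -[m x v]linmE.
by apply: memv_brv; apply: memv_img.
Qed.

(* Nakayama: the generators can be removed one at a time, since a nilpotent
   generator [x] can be absorbed into the sum of the other ones. *)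
Lemma nilpotent_generators I (s : seq A) : alg_ideal I ->
  (forall x, x \in s -> exists j, mul_iter I x j = 0%VS) ->
  (I <= \sum_(x <- s) linfun (m x) @: I)%VS -> I = 0%VS.
Proof.
move=> Iid; elim: s => [|x s IHs] nil.
  by rewrite big_nil subv0 => /eqP.
rewrite big_cons; set K := (\sum_(y <- s) _)%VS => IK.
apply: IHs => [y ys|]; first by apply: nil; rewrite inE ys orbT.
have Kx : (linfun (m x) @: K <= K)%VS.
  rewrite limg_sum /K; elim: (s) => [|y t IHt]; rewrite ?big_nil // !big_cons.
  apply: addvS => //; apply/sub_limgP => _ /memv_imgP[z zI ->].
  by rewrite !linmE mCA -linmE; apply/memv_img/Iid.
have step j : (I <= mul_iter I x j + K)%VS.
  elim: j => [|j IHj]; first exact: addvSl.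
  apply: subv_trans IK _; rewrite subv_add addvSr andbT.
  apply: subv_trans (limgS _ IHj) _.
  by rewrite limgD; apply: addvS.
have [|j Ij0] := nil x; first by rewrite inE eqxx.
by have := step j; rewrite Ij0 add0v.
Qed.

(** Only vectors fixed by a common idempotent are constrained, so nonzero elements of square zero
    may still exist elsewhere. *)
Hypothesis formally_real : forall e u w, m e e = e -> m e u = u ->
  m e w = w -> m u u + m w w = 0 -> u = 0.

(* An ideal that is minimal among the nonzero idempotent ones has a unit [e];
   a real eigenvalue [c] of [y] on it makes [y - c e] nilpotent, hence zero. *)
Lemma idempotent_line I : alg_ideal I -> brv m I I = I -> I != 0%VS ->
  exists e, [/\ e \in I, e != 0, m e e = e &
    forall y, m e y = y -> y \in <[e]>%VS].
Proof.
have [n] := ubnP (\dim I); elim: n I => // n IHn I ltIn Iid I2 I0.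
have [//|no_line] := EM (exists e, [/\ e \in I, e != 0, m e e = e &
  forall y, m e y = y -> y \in <[e]>%VS]).
(* A stable [W] other than [0] and [I] would be a smaller nonzero idempotent ideal, and the
   induction hypothesis would provide the forbidden [e] inside it. *)
have dich x j (W := mul_iter I x j) :
    (linfun (m x) @: W)%VS = W -> W = 0%VS \/ W = I.
  move=> xW; have [->|W0] := eqVneq W 0%VS; [by left|right].
  apply/eqP; apply: contra_notT no_line => WI.
  have sWI : (W <= I)%VS by exact: mul_iter_sub.
  have W2 : brv m W W = W.
    apply/eqP; rewrite eqEsubv; apply/andP; split.
      by apply/brv_subP => y z yW zW; apply: mul_iter_ideal.
    rewrite -{1}(iter_stable j xW) /W -{1}I2.
    exact: mul_iter_brv.
  have [||||e [eW e0 ee eA]] := IHn W => //.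
    rewrite -ltnS (leq_trans _ ltIn) // ltnS ltn_neqAle dimvS // andbT.
    by apply: contraNneq WI => eqd; rewrite eqEdim sWI eqd /=.
    exact: mul_iter_ideal.
  by exists e; split=> //; exact: (subvP sWI).
(* If no element acted invertibly, every basis vector would be nilpotent on [I], and [I = I I] would
   vanish by [nilpotent_generators]. *)
have [x xI xII] : exists2 x, x \in I & (linfun (m x) @: I)%VS = I.
  apply: contraPP I0 => noinv; apply/negP; rewrite negbK; apply/eqP.
  apply: (@nilpotent_generators _ (vbasis I)) => // [x /vbasis_mem xI|].
    have [j xj] := mul_iter_stable x Iid; exists j.
    have [//|Wj] := dich _ _ xj; case: noinv; exists x => //.
    by rewrite -{2}Wj -xj Wj.
  rewrite -{1}I2; apply/span_subvP => _ /allpairsP[[u v] /=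
    [uB /vbasis_mem vI ->]]; rewrite -linmE (big_rem _ uB) /=.
  by apply: (subvP (addvSl _ _)); apply: memv_img.
(* Once [x = x e], the element [e] is a unit, because every [w] in [I] has the form [x v]. *)
have [e eI xe] : exists2 e, e \in I & x = m x e.
  move: xI; rewrite -{1}xII => /memv_imgP[e eI xe].
  by exists e; rewrite -?linmE.
have eid w : w \in I -> m e w = w.
  rewrite -{1}xII => /memv_imgP[v vI ->].
  by rewrite !linmE mA (mC e) -xe.
have e0 : e != 0.
  apply: contraNneq I0 => e0; rewrite -subv0; apply/subvP => w /eid <-.
  by rewrite e0 linear0l mem0v.
case: no_line; exists e; split=> // [|y ey]; first exact: eid.
have yI : y \in I by rewrite -ey mC; apply: Iid.
have [|a [b [u [w [uI wI uw0 yu yw]]]]] :=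
  complex_eigenvector (f := linfun (m y)) I0.
  by apply/sub_limgP => z zI; rewrite linmE; apply: Iid.
rewrite !linmE in yu yw.
(* Multiplication by [y] is symmetric: comparing [(y u) w] with [u (y w)] gives
   [b (u u + w w) = 0]. *)
have b0 : b = 0.
  apply/eqP; apply: contraTT uw0 => b0.
  have : b *: (m u u + m w w) = 0.
    have : m (m y u) w = m u (m y w) by rewrite -mA mCA.
    rewrite yu yw linearBl linearDr !linearZl_LR !linearZr_LR /=.
    by rewrite addrC => /addIr eq0; rewrite scalerDr -eq0 addNr.
  move/eqP; rewrite scaler_eq0 (negPf b0) /= => /eqP uuww.
  rewrite negb_or !negbK; apply/andP; split; apply/eqP.
    by apply: (formally_real (e := e) (w := w)); rewrite ?eid.
  by apply: (formally_real (e := e) (w := u)); rewrite ?eid // addrC.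
have [z [zI z0 yz]] : exists z, [/\ z \in I, z != 0 & m (y - a *: e) z = 0].
  have kill v : v \in I -> m y v = a *: v -> m (y - a *: e) v = 0.
    by move=> vI yv; rewrite linearBl linearZl_LR /= eid // yv subrr.
  rewrite b0 !scale0r subr0 in yu; rewrite b0 scale0r add0r in yw.
  by case/orP: uw0 => [u0|w0]; [exists u|exists w]; split=> //; apply: kill.
set y' := y - a *: e in yz.
have y'I : y' \in I by rewrite memvB // memvZ.
have [j yj] := mul_iter_stable y' Iid.
(* The nonzero [z] is killed by [y'], which therefore does not act invertibly; the dichotomy leaves
   only nilpotency. *)
have [W0|WI] := dich _ _ yj; last first.
  have y'II : (linfun (m y') @: I)%VS = I by rewrite -{2}WI -yj WI.
  have /eqP := limg_eq_inj y'II zI (etrans (linmE _ _) yz).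
  by rewrite (negPf z0).
have : iter j (m y') e = 0.
  by apply/eqP; rewrite -memv0 -W0 mem_mul_iter.
have itI i : iter i (m y') e \in I by elim: i => //= i; apply: Iid.
move=> y'0; suff y'e : m y' e = 0.
  apply/vlineP; exists a; apply/eqP.
  by rewrite -subr_eq0 -/y' -(eid _ y'I) mC y'e.
have {y'0} : iter j.+1 (m y') e = 0 by rewrite iterS y'0 linear0r.
elim: j {yj W0} => // j IHj y'0; apply: IHj.
(* The square of [v] is the product of [iter j (m y') e] and [iter j.+2 (m y') e], hence zero, and
   formal reality gives [v = 0]. *)
set v := iter j.+1 _ _ in y'0 *.
apply: (formally_real (e := e) (w := 0)); rewrite ?eid ?mem0v ?itI //.
rewrite linear0l addr0 {1}/v iterS -mA mCA.
rewrite -/(iter j.+1 (m y') e) -/v -[m y' v]/(iter j.+2 (m y') e).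
by rewrite y'0 linear0r.
Qed.

End CommutativeAlgebra.

(** * The SKT condition *)

Section LowDegree.
Variable V : nmodType.

Definition tupf (n : nat) (s : seq V) : {ffun 'I_n -> V} :=
  [ffun i : 'I_n => s`_i].

Lemma sum_lt3 (F : 'I_3 -> 'I_3 -> V) :
  \sum_(i < 3) \sum_(j < 3 | (i < j)%N) F i j =
  F (@Ordinal 3 0 isT) (@Ordinal 3 1 isT) +
  F (@Ordinal 3 0 isT) (@Ordinal 3 2 isT) +
  F (@Ordinal 3 1 isT) (@Ordinal 3 2 isT).
Proof.
under eq_bigr do rewrite big_mkcond.
rewrite !big_ord_recl !big_ord0 /= !add0r !addr0.
by congr (_ + _ + _); congr (F _ _); apply: val_inj.
Qed.

Lemma sum_lt4 (F : 'I_4 -> 'I_4 -> V) :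
  \sum_(i < 4) \sum_(j < 4 | (i < j)%N) F i j =
  F (@Ordinal 4 0 isT) (@Ordinal 4 1 isT) +
  F (@Ordinal 4 0 isT) (@Ordinal 4 2 isT) +
  F (@Ordinal 4 0 isT) (@Ordinal 4 3 isT) +
  F (@Ordinal 4 1 isT) (@Ordinal 4 2 isT) +
  F (@Ordinal 4 1 isT) (@Ordinal 4 3 isT) +
  F (@Ordinal 4 2 isT) (@Ordinal 4 3 isT).
Proof.
under eq_bigr do rewrite big_mkcond.
rewrite !big_ord_recl !big_ord0 /= !add0r !addr0.
rewrite !addrA.
by congr (_ + _ + _ + _ + _ + _); congr (F _ _); apply: val_inj.
Qed.

End LowDegree.

Section SKTIdentity.
Variables (R : realType) (V : vectType R).
Variables (br : {bilinear V -> V -> V}) (J : 'End(V)) (g : {biscalar V}).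

(* [d^c w], for [w] the fundamental form of [g] *)
Definition torsion (x y z : V) : R :=
  g (br (J x) (J y)) z + g (br (J y) (J z)) x + g (br (J z) (J x)) y.

Hypothesis brxx : forall x, br x x = 0.
Hypothesis JJ : (J \o J)%VF = - \1%VF.
Hypothesis gskt : SKT_metric br J g.

Let brC x y : br x y = - br y x.
Proof.
apply/eqP; rewrite -addr_eq0; have /eqP := brxx (x + y).
by rewrite linearDl !linearDr /= !brxx add0r addr0.
Qed.

Let JJE x : J (J x) = - x.
Proof. by rewrite -comp_lfunE JJ opp_lfunE id_lfunE. Qed.

Let JV x : (J^-1)%VF x = - J x.
Proof.
have Ji : injective J by move=> y z /(congr1 J); rewrite !JJE => /oppr_inj.
apply: (Ji); rewrite lker0_lfunVK; last exact/lker0P.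
by rewrite linearN /= JJE opprK.
Qed.

Lemma d_form2 (c : {ffun 'I_2 -> V} -> R^o) x y z :
  d_form br c (tupf 3 [:: x; y; z]) =
  - c (tupf 2 [:: br x y; z]) + c (tupf 2 [:: br x z; y]) +
    c (tupf 2 [:: x; br y z]).
Proof.
rewrite /d_form /ce_d big1 ?add0r; last by move=> i _; rewrite scaler0.
rewrite sum_lt3 /= expr1 sqrrN expr1n !scaleN1r !scale1r.
by congr (- c _ + c _ + c _); apply/ffunP => -[[|[|[]]] //= lt];
  rewrite !ffunE -val_eqE /=.
Qed.

Lemma d_form3 (c : {ffun 'I_3 -> V} -> R^o) x y z w :
  d_form br c (tupf 4 [:: x; y; z; w]) =
  - c (tupf 3 [:: br x y; z; w]) + c (tupf 3 [:: br x z; y; w]) -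
    c (tupf 3 [:: br x w; y; z]) + c (tupf 3 [:: x; br y z; w]) -
    c (tupf 3 [:: x; br y w; z]) - c (tupf 3 [:: x; y; br z w]).
Proof.
rewrite /d_form /ce_d big1 ?add0r; last by move=> i _; rewrite scaler0.
rewrite sum_lt4 /= expr1 sqrrN expr1n exprS sqrrN expr1n mulr1.
rewrite !scaleN1r !scale1r.
by congr (- c _ + c _ - c _ + c _ - c _ - c _);
  apply/ffunP => -[[|[|[|[]]]] //= lt]; rewrite !ffunE -val_eqE /=.
Qed.

(** The fundamental form is [J]-invariant and [J^-1 = - J], so the left side is minus its
    differential at [(Jx, Jy, Jz)]; invariance of [g] under [J] then removes the outer [J]. *)
Lemma dc_fundamental x y z :
  dc_form br J (fundamental_form J g) (tupf 3 [:: x; y; z]) = torsion x y z.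
Proof.
have [gC _ gJ _] := gskt.
have pullE n f (c : {ffun 'I_n -> V} -> R^o) s : (size s = n)%N ->
    pull f c (tupf n s) = c (tupf n (map f s)).
  move=> sn; rewrite /pull; congr (c _); apply/ffunP => i; rewrite !ffunE.
  by rewrite (nth_map 0) ?sn.
rewrite /dc_form pullE //= d_form2 !pullE //= /fundamental_form !ffunE /=.
rewrite !JV !linearN /= !JJE !opprK.
rewrite !linearNl /= ?linearNr ?linearNl ?linearN /= ?linearNr ?linearNl.
rewrite ?opprK gJ /=.
rewrite /torsion [br (J z) (J x)]brC linearNl /= (gC x).
by rewrite [LHS]addrAC.
Qed.

Lemma torsion_closed x y z w :
  - torsion (br x y) z w + torsion (br x z) y w - torsion (br x w) y z +
  torsion x (br y z) w - torsion x (br y w) z - torsion x y (br z w) = 0.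
Proof.
have [_ _ _ /(_ (tupf 4 [:: x; y; z; w])) <-] := gskt.
by rewrite d_form3 !dc_fundamental.
Qed.


End SKTIdentity.


(** * The algebra [a/k] *)

Section TwoStep.
Variables (R : realType) (V : vectType R).
Variables (br : {bilinear V -> V -> V}) (J : 'End(V)).
Hypothesis br_lie : lie_bracket br.
Hypothesis br_2step : two_step_solvable br.
Hypothesis J_complex : complex_structure br J.

Local Notation a := (derv br).
Local Notation k := (derJ br J).
Local Notation "x ** y" := (br (J x) y) (at level 40, left associativity).

Lemma bracketC x y : br x y = - br y x.
Proof.
have [brxx _] := br_lie.
apply/eqP; rewrite -addr_eq0; have /eqP := brxx (x + y).
by rewrite linearDl !linearDr /= !brxx add0r addr0.
Qed.

Lemma J_J x : J (J x) = - x.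
Proof.
by have [JJ _] := J_complex; rewrite -comp_lfunE JJ opp_lfunE id_lfunE.
Qed.

Lemma jacobi x y z : br x (br y z) = br (br x y) z + br y (br x z).
Proof.
have [_ /(_ x y z)] := br_lie.
rewrite [br z (br x y)]bracketC [br z x]bracketC linearNr => /eqP.
by rewrite -addrA -opprD subr_eq0 => /eqP->; rewrite addrC.
Qed.

Lemma bracket_derv x y : br x y \in a.
Proof. by apply: memv_brv; apply: memvf. Qed.

Lemma derv_abelian x y : x \in a -> y \in a -> br x y = 0.
Proof.
move=> xa ya; apply/eqP; rewrite -memv0 -br_2step.
exact: memv_brv.
Qed.

Lemma mem_derJ x : (x \in k) = (x \in a) && (J x \in a).
Proof.
rewrite memv_cap; congr andb; apply/memv_imgP/idP => [[y ya ->]|xa].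
  by rewrite J_J memvN.
by exists (- J x); rewrite ?memvN // linearN /= J_J opprK.
Qed.

Lemma derJ_sub x : x \in k -> x \in a.
Proof. by rewrite mem_derJ => /andP[]. Qed.

Lemma derJ_J x : x \in k -> J x \in k.
Proof. by rewrite !mem_derJ J_J memvN andbC. Qed.

Lemma nijenhuis x y : br (J x) (J y) = br x y + J (x ** y + br x (J y)).
Proof.
have [_ /(_ x y)/eqP] := J_complex.
by rewrite subr_eq0 => /eqP <-; rewrite linearD /= addrA.
Qed.

(** By Jacobi the two sides differ by the action of [[x, y]], an element of the abelian [a]. *)
Lemma ad_commute x y z : z \in a -> br x (br y z) = br y (br x z).
Proof.
by move=> za; rewrite jacobi (derv_abelian (bracket_derv x y) za) add0r.
Qed.

(** By the Nijenhuis identity [J] maps this difference to [[Jx, Jy]], which lies in [a]. *)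
Lemma mulJ_comm x y : x \in a -> y \in a -> x ** y - y ** x \in k.
Proof.
move=> xa ya; rewrite mem_derJ memvB ?bracket_derv //=.
have -> : J (x ** y - y ** x) = br (J x) (J y).
  by rewrite nijenhuis (derv_abelian xa ya) add0r [br x _]bracketC.
exact: bracket_derv.
Qed.

Lemma mulJ_kill x y : x \in k -> y \in a -> x ** y = 0.
Proof. by move=> /derJ_J/derJ_sub xa ya; apply: derv_abelian. Qed.

Lemma mulJ_J x z : x \in a -> z \in k -> x ** J z = J (x ** z).
Proof.
move=> xa zk; have za := derJ_sub zk; have Jza := derJ_sub (derJ_J zk).
rewrite nijenhuis (derv_abelian xa za) add0r.
by rewrite (derv_abelian xa Jza) addr0.
Qed.

Lemma mulJ_derJ x z : x \in a -> z \in k -> x ** z \in k.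
Proof. by move=> xa zk; rewrite mem_derJ -mulJ_J // !bracket_derv. Qed.

Lemma mulJ_congr x x' y y' : x' \in a -> y \in a -> y' \in a ->
  x - x' \in k -> y - y' \in k -> x ** y - x' ** y' \in k.
Proof.
move=> x'a ya y'a xx' yy'.
have -> : x ** y - x' ** y' = (x - x') ** y + x' ** (y - y').
  by rewrite linearB linearBl /= linearBr /= addrA subrK.
by rewrite mulJ_kill // add0r mulJ_derJ.
Qed.

(** Associativity follows from commutativity modulo [k] and commuting operators: [(x ** y) ** z]
    becomes [z ** (x ** y) = x ** (z ** y)], then [x ** (y ** z)]. *)
Lemma mulJ_assoc x y z : x \in a -> y \in a -> z \in a ->
  (x ** y) ** z - x ** (y ** z) \in k.
Proof.
move=> xa ya za.
have xya := bracket_derv (J x) y; have yza := bracket_derv (J y) z.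
have c1 := mulJ_comm xya za.
have c2 := mulJ_comm za ya.
have c3 : x ** (z ** y) - x ** (y ** z) \in k.
  by rewrite -linearBr mulJ_derJ.
have -> : x ** y ** z - x ** (y ** z) =
   (x ** y ** z - z ** (x ** y)) + (x ** (z ** y) - x ** (y ** z)).
  by rewrite [z ** (x ** y)]ad_commute // addrA subrK.
exact: memvD.
Qed.

(** * Idempotents modulo $\mathfrak g'_J$ under an SKT metric *)

Section Metric.
Variable g : {biscalar V}.
Hypothesis gskt : SKT_metric br J g.

Let g0 x : g x x = 0 -> x = 0.
Proof.
move=> gx; apply/eqP/negP => /negP x0; have [_ /(_ x x0)] := gskt.
by rewrite gx ltxx.
Qed.

Let closed x y z w :=
  torsion_closed (proj1 br_lie) (proj1 J_complex) gskt x y z w.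

(* [dd^c w] at [(Je, e, z, Jz)] is [-6 g z z]. *)
Lemma idem_eigen e z : e \in a -> e ** e - e \in k -> z \in k ->
  e ** z = z -> z = 0.
Proof.
move=> ea ek zk ez; have za := derJ_sub zk; have Jzk := derJ_J zk.
have Jza := derJ_sub Jzk.
have eJz : e ** J z = J z by rewrite mulJ_J // ez.
(* The defect [e ** e - e] lies in [k] and so kills [a] from the left. *)
have wz u : u \in a -> (e ** e) ** u = e ** u.
  move=> ua; apply/eqP; rewrite -subr_eq0 -linearBl -linearB /=.
  by rewrite (mulJ_kill ek ua).
have := closed (J e) e z (J z).
rewrite ez eJz !(derv_abelian ea) // (derv_abelian za) //.
rewrite /torsion !J_J !linear0 ?linear0l ?linear0r /= !wz //.
have ze : br z (J e) = - z by rewrite bracketC ez.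
have zee : br z (J (e ** e)) = - z by rewrite bracketC wz // ez.
have Jze : br (J z) (J e) = - J z by rewrite bracketC eJz.
rewrite eJz Jze !linearNr !linearNl /= ?linearNr ze zee ez.
rewrite (derv_abelian za Jza) (derv_abelian Jza za).
have [_ _ gJ _] := gskt; rewrite ?linearNl /= ?linear0l !gJ => gzz.
by apply: g0; lra.
Qed.

Lemma idem_solve e w : e \in a -> e ** e - e \in k -> w \in k ->
  exists2 v, v \in k & e ** v - v = w.
Proof.
move=> ea ek wk; pose f : 'End(V) := (linfun (br (J e)) - \1)%VF.
have fE v : f v = e ** v - v.
  by rewrite add_lfunE opp_lfunE id_lfunE lfunE.
have fk : (f @: k)%VS = k.
  apply: inj_limg_eq => [v vk|v vk]; first by rewrite fE memvB // mulJ_derJ.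
  by rewrite fE => /eqP; rewrite subr_eq0 => /eqP; apply: idem_eigen.
move: wk; rewrite -{1}fk => /memv_imgP[v vk ->].
by exists v; rewrite ?fE.
Qed.

(** The defect [e ** y - y] equals [e ** v - v] for some [v] in [k]; subtracting [v] from [y]
    removes it. *)
Lemma eigen_lift e y : e \in a -> e ** e - e \in k -> y \in a ->
  e ** y - y \in k -> exists y', [/\ y' \in a, y' - y \in k & e ** y' = y'].
Proof.
move=> ea ek ya /(idem_solve ea ek)[v vk vE].
exists (y - v); split; first by rewrite memvB // derJ_sub.
  by rewrite addrAC subrr add0r memvN.
have ev : e ** v = e ** y - y + v by rewrite -vE subrK.
by rewrite linearBr /= ev opprD opprB addrA addrCA subrr addr0.
Qed.

(** Lift [e0] as an eigenvector of itself. Replacing [e0] by the lift in the left factor changes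
    nothing, since [k] kills [a] from the left. *)
Lemma idem_lift e0 : e0 \in a -> e0 ** e0 - e0 \in k ->
  exists e, [/\ e \in a, e - e0 \in k & e ** e = e].
Proof.
move=> e0a e0k; have [e [ea ek ee]] := eigen_lift e0a e0k e0a e0k.
exists e; split=> //; rewrite -{3}ee; apply/eqP.
by rewrite -subr_eq0 -linearBl -linearB /= (mulJ_kill ek ea).
Qed.

Section Idempotent.
Variable e : V.
Hypotheses (ea : e \in a) (ee : e ** e = e).

Let ek : e ** e - e \in k.
Proof. by rewrite ee subrr mem0v. Qed.

Lemma eigen_derJ z : z \in k -> e ** z = z -> z = 0.
Proof. exact: idem_eigen. Qed.

Lemma eigen_mul x y : y \in a -> e ** y = y -> e ** (br x y) = br x y.
Proof. by move=> ya ey; rewrite ad_commute // ey. Qed.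

(** The difference [y ** e - y] equals [y ** e - e ** y], so it lies in [k]; being fixed by [e **],
    it is zero. *)
Lemma eigen_unit y : y \in a -> e ** y = y -> y ** e = y.
Proof.
move=> ya ey; apply/eqP; rewrite -subr_eq0; apply/eqP/eigen_derJ.
  by rewrite -{2}ey mulJ_comm.
by rewrite linearBr /= (eigen_mul _ ea ee) ey.
Qed.

(* [dd^c w] at [(Je, Jy, e, y)] is [2 (g (y ** y) e - g y y)]. *)
Lemma eigen_square_metric y : y \in a -> e ** y = y -> g (y ** y) e = g y y.
Proof.
move=> ya ey; set q := y ** y.
have qa : q \in a by exact: bracket_derv.
have eq : e ** q = q by exact: eigen_mul.
have ye := eigen_unit ya ey; have qe := eigen_unit qa eq.
(* By the Nijenhuis identity this bracket is [J (e ** x - x ** e)], which vanishes by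
   [eigen_unit]. *)
have anti x : x \in a -> e ** x = x -> br (J e) (J x) = 0.
  move=> xa ex; rewrite nijenhuis (derv_abelian ea xa) add0r ex.
  by rewrite [br e (J x)]bracketC eigen_unit // subrr linear0.
have antiC x : x \in a -> e ** x = x -> br (J x) (J e) = 0.
  by move=> xa ex; rewrite bracketC anti // oppr0.
have := closed (J e) (J y) e y.
rewrite anti // ee ey ye -/q (derv_abelian ea ya) /torsion !J_J.
rewrite !linear0 ?linear0l ?linear0r /= !anti // !antiC //.
rewrite ?linear0l ?linear0r /=.
have [brxx _] := br_lie; rewrite !brxx ?linear0l.
rewrite !linearNr !linearNl /= ?linearNr ?linearNl ee ey ye -/q.
have [gC _ _ _] := gskt.
rewrite [br y (J y)]bracketC [br y (J e)]bracketC [br e (J y)]bracketC.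
rewrite [br e (J q)]bracketC !linearNl /= -/q ey ye qe (gC e q).
by move=> sum0; lra.
Qed.

End Idempotent.

(** After lifting, the sum of squares lies in [k] and is fixed by the idempotent, so it is exactly
    zero. Pairing it with the idempotent gives a sum of two squared norms. *)
Lemma formally_real_mod_derJ e u w : e \in a -> u \in a -> w \in a ->
  e ** e - e \in k -> e ** u - u \in k -> e ** w - w \in k ->
  u ** u + w ** w \in k -> u \in k.
Proof.
move=> ea ua wa ek uk wk uwk.
have [e' [e'a e'e ee']] := idem_lift ea ek.
have ek' : e' ** e' - e' \in k by rewrite ee' subrr mem0v.
have lift y : y \in a -> e ** y - y \in k ->
    exists y', [/\ y' \in a, y' - y \in k & e' ** y' = y'].
  move=> ya yk; apply: eigen_lift => //.
  have -> : e' ** y - y = (e' - e) ** y + (e ** y - y).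
    by rewrite linearB linearBl /= addrA subrK.
  by rewrite mulJ_kill ?add0r.
have [u' [u'a u'u eu']] := lift u ua uk.
have [w' [w'a w'w ew']] := lift w wa wk.
have qk : u' ** u' + w' ** w' \in k.
  rewrite -[_ + _](subrK (u ** u + w ** w)) memvD // opprD addrACA.
  by rewrite memvD // mulJ_congr.
have q0 : u' ** u' + w' ** w' = 0.
  by apply: (eigen_derJ e'a ee' qk); rewrite linearDr /= !eigen_mul.
have [_ gpos _ _] := gskt.
have ge0 x : 0 <= g x x.
  by have [->|/gpos/ltW//] := eqVneq x 0; rewrite linear0l.
have u'0 : u' = 0.
  apply: g0; have : g (u' ** u' + w' ** w') e' = 0 by rewrite q0 linear0l.
  rewrite linearDl /= !eigen_square_metric //.
  by have := ge0 u'; have := ge0 w'; lra.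
by move: u'u; rewrite u'0 sub0r memvN.
Qed.

End Metric.
End TwoStep.

(** * The quotient of $\mathfrak g'$ by $\mathfrak g'_J$ as a commutative associative algebra *)

Section QuotientAlgebra.
Variables (R : realType) (V : vectType R).
Variables (br : {bilinear V -> V -> V}) (J : 'End(V)).

(* [a/k], carried by a complement of [k] in [a] *)
Definition quoA : vectType R := subvs_of (derv br :\: derJ br J)%VS.

Definition quoA_pi : 'Hom(V, quoA) :=
  (linfun (vsproj (derv br :\: derJ br J)) \o
   addv_pi1 (derv br) (derJ br J))%VF.

Definition quoA_mul (x y : quoA) : quoA := quoA_pi (br (J (vsval x)) (vsval y)).

Lemma quoA_mul_bilinear : bilinear_for *:%R *:%R quoA_mul.
Proof.
split=> x c y z; rewrite /quoA_mul.
  by rewrite !linearP linearPl linearP.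
by rewrite !linearP.
Qed.

HB.instance Definition _ :=
  bilinear_isBilinear.Build R quoA quoA quoA _ _ quoA_mul quoA_mul_bilinear.

Hypothesis br_lie : lie_bracket br.
Hypothesis br_2step : two_step_solvable br.
Hypothesis J_complex : complex_structure br J.

Local Notation a := (derv br).
Local Notation k := (derJ br J).
Local Notation pi := quoA_pi.

Lemma quoA_val (x : quoA) : vsval x \in a.
Proof. by apply: (subvP (diffvSl a k)); apply: subvsP. Qed.

Lemma quoA_piP x : x \in a -> x - vsval (pi x) \in k.
Proof.
move=> xa; rewrite /quoA_pi comp_lfunE lfunE /= vsprojK; last exact: memv_pi.
rewrite -{1}(@addv_pi1_pi2 _ _ a k x); last exact: (subvP (addvSl _ _)).
by rewrite addrC addKr memv_pi2.
Qed.

Lemma quoA_pi_eq0 x : x \in a -> (pi x == 0) = (x \in k).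
Proof.
move=> xa; apply/eqP/idP => [px|xk].
  by have := quoA_piP xa; rewrite px [vsval _]linear0 subr0.
apply: subvs_inj; apply/eqP; rewrite [vsval 0]linear0.
rewrite -memv0 -(capv_diff a k) memv_cap subvsP.
by rewrite -[vsval _](subKr x) memvB // quoA_piP.
Qed.

Lemma quoA_pi_eq x y : x \in a -> y \in a -> (pi x == pi y) = (x - y \in k).
Proof. by move=> xa ya; rewrite -subr_eq0 -linearB quoA_pi_eq0 // memvB. Qed.

Lemma quoA_valK : cancel vsval pi.
Proof.
move=> x; apply: subvs_inj; apply/eqP.
rewrite -subr_eq0 -memv0 -(capv_diff a k).
rewrite memv_cap memvB ?subvsP //= -opprB memvN.
exact: quoA_piP (quoA_val x).
Qed.

Lemma quoA_pi_mul x y : x \in a -> y \in a ->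
  quoA_mul (pi x) (pi y) = pi (br (J x) y).
Proof.
move=> xa ya; apply/eqP; rewrite quoA_pi_eq ?bracket_derv //.
by rewrite mulJ_congr ?quoA_val // -opprB memvN quoA_piP.
Qed.

Lemma quoA_mulC x y : quoA_mul x y = quoA_mul y x.
Proof.
by apply/eqP; rewrite quoA_pi_eq ?bracket_derv // mulJ_comm ?quoA_val.
Qed.

Lemma quoA_mulA x y z :
  quoA_mul x (quoA_mul y z) = quoA_mul (quoA_mul x y) z.
Proof.
rewrite -(quoA_valK x) -(quoA_valK y) -(quoA_valK z).
rewrite !quoA_pi_mul ?quoA_val ?bracket_derv //.
apply/eqP; rewrite quoA_pi_eq ?bracket_derv // -opprB memvN.
by apply: mulJ_assoc; rewrite ?quoA_val.
Qed.

Variable g : {biscalar V}.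
Hypothesis gskt : SKT_metric br J g.

Lemma quoA_formally_real e u w : quoA_mul e e = e -> quoA_mul e u = u ->
  quoA_mul e w = w -> quoA_mul u u + quoA_mul w w = 0 -> u = 0.
Proof.
rewrite -(quoA_valK e) -(quoA_valK u) -(quoA_valK w).
rewrite !quoA_pi_mul ?quoA_val // -linearD.
move=> /eqP + /eqP + /eqP + /eqP.
rewrite !quoA_pi_eq ?bracket_derv ?quoA_val //.
rewrite quoA_pi_eq0; last by rewrite memvD ?bracket_derv.
move=> ee eu ew uw; apply/eqP; rewrite quoA_pi_eq0 ?quoA_val //.
have [ea ua wa] := And3 (quoA_val e) (quoA_val u) (quoA_val w).
exact: (formally_real_mod_derJ br_lie br_2step J_complex gskt
  ea ua wa ee eu ew uw).
Qed.

(** Both the idempotent and its line lift from [a/k]: if [e ** y = y], then some [y - c e] lies in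
    [k] and is fixed by [e **], hence is zero. *)
Lemma derv_idempotent_line (I : {vspace quoA}) :
  alg_ideal quoA_mul I -> brv quoA_mul I I = I -> I != 0%VS ->
  exists e, [/\ e \in a, e != 0, br (J e) e = e, pi e \in I &
    forall y, y \in a -> br (J e) y = y -> y \in <[e]>%VS].
Proof.
move=> Iid I2 I0.
have [e0 [e0I e00 e0e0 line]] :=
  idempotent_line quoA_mulC quoA_mulA quoA_formally_real Iid I2 I0.
have e0a := quoA_val e0.
have e0k : br (J (vsval e0)) (vsval e0) - vsval e0 \in k.
  by rewrite -quoA_pi_eq ?bracket_derv // -quoA_pi_mul // quoA_valK e0e0.
have [e [ea ek ee]] := idem_lift br_lie br_2step J_complex gskt e0a e0k.
have pe : pi e = e0.
  by apply/eqP; rewrite -[e0]quoA_valK quoA_pi_eq.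
exists e; split; rewrite ?pe //.
  by apply: contraNneq e00 => e0'; rewrite -pe e0' linear0.
move=> y ya ey; have : pi y \in <[e0]>%VS.
  by apply: line; rewrite -pe [LHS]quoA_pi_mul // ey.
case/vlineP => c; rewrite -pe -linearZ => /eqP; rewrite quoA_pi_eq ?memvZ //.
move=> yk; apply/vlineP; exists c; apply/eqP; rewrite -subr_eq0; apply/eqP.
apply: (eigen_derJ br_lie br_2step J_complex gskt ea ee yk).
by rewrite linearBr linearZr_LR /= ey ee.
Qed.

End QuotientAlgebra.
(** * Weights and the radical *)

Section Roots.
Variables (R : realType) (V : vectType R).
Variables (br : {bilinear V -> V -> V}) (J : 'End(V)) (g : {biscalar V}).
Hypothesis br_lie : lie_bracket br.
Hypothesis br_2step : two_step_solvable br.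
Hypothesis J_complex : complex_structure br J.
Hypothesis gskt : SKT_metric br J g.

Local Notation a := (derv br).
Local Notation k := (derJ br J).
Local Notation "x ** y" := (br (J x) y) (at level 40, left associativity).

Let br_a := bracket_derv br.
Let ab0 := derv_abelian br_2step.
Let brC := bracketC br_lie.
Let JJ := J_J J_complex.
Let adC := ad_commute br_lie br_2step.
Let mulC := mulJ_comm br_lie br_2step J_complex.
Let kill := mulJ_kill br_2step J_complex.
Let ksub := derJ_sub J_complex.

Definition is_root (e : V) : Prop :=
  [/\ e \in a, e != 0, e ** e = e &
      forall y, y \in a -> e ** y = y -> y \in <[e]>%VS].

(** For a root [e] every [ad z] preserves the line of [e], and this is the scalar by which it acts
    there. *)
Definition weight (e z : V) : R := coord [tuple e] ord0 (br z e).

Lemma weightD e z w : weight e (z + w) = weight e z + weight e w.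
Proof. by rewrite /weight linearDl linearD. Qed.

Lemma weightN e z : weight e (- z) = - weight e z.
Proof. by rewrite /weight linearNl linearN. Qed.

Lemma weight_eq e z c : e != 0 -> br z e = c *: e -> weight e z = c.
Proof.
move=> e0 ze; rewrite /weight ze linearZ /=.
by rewrite (@coord_free _ _ _ [tuple e] ord0 ord0) ?seq1_free // [LHS]mulr1.
Qed.

Section OneRoot.
Variable e : V.
Hypothesis e_root : is_root e.

Let ea : e \in a. Proof. by case: e_root. Qed.
Let e0 : e != 0. Proof. by case: e_root. Qed.
Let ee : e ** e = e. Proof. by case: e_root. Qed.
Let ek : e ** e - e \in k. Proof. by rewrite ee subrr mem0v. Qed.

Lemma weightE z : br z e = weight e z *: e.
Proof.
have [_ _ _ line] := e_root.
have /vlineP[c zc] : br z e \in <[e]>%VS by apply: line; rewrite // adC // ee.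
by rewrite (weight_eq e0 zc).
Qed.

Lemma weight_derv y : y \in a -> weight e y = 0.
Proof. by move=> ya; apply: weight_eq => //; rewrite ab0 // scale0r. Qed.

Lemma weight_J_root : weight e (J e) = 1.
Proof. by apply: weight_eq; rewrite // ee scale1r. Qed.

(** The eigenvalue 1 has no Jordan block above [e]. Commutativity modulo [k] gives
    [e ** v = z + c e] with [z] in [k]. If [e ** v - v = e], then [v = z + (c - 1) e], so
    [e = e ** z - z] lies in [k], where [e **] fixes only zero. *)
Lemma root_notin_image v : v \in a -> e ** v - v != e.
Proof.
move=> va; apply/negP => /eqP ev; set c := weight e (J v).
have [z zk zE] : exists2 z, z \in k & e ** v = z + c *: e.
  by exists (e ** v - c *: e); rewrite ?subrK // /c -weightE mulC.
have vE : v = (c - 1) *: e + z.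
  rewrite scalerBl scale1r addrC addrA -zE.
  by rewrite -[X in _ - X]ev opprB addrC subrK.
have eE : e ** z - z = e.
  rewrite -[RHS]ev [in RHS]vE linearD linearZ /= ee.
  by rewrite opprD addrACA subrr add0r.
have : e \in k by rewrite -eE memvB // mulJ_derJ.
move=> /(eigen_derJ br_lie br_2step J_complex gskt ea ee)/(_ ee)/eqP.
by rewrite (negPf e0).
Qed.

(** The commutators [z1], [z2] have the form [e ** v - v] with [v] in [k]. In [z1 + [z, z2]] the
    terms [e ** [z, y]] cancel, and what remains is [e] times the difference of the two sides. So
    this multiple of [e] is some [e ** u - u], and [root_notin_image] makes it zero. *)
Lemma weight_J_bracket_derv z y :
  y \in a -> weight e (J (br z y)) = weight e z * weight e (J y).
Proof.
move=> ya; set c := weight e z; set d := weight e (J y).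
pose z1 := br z y ** e - e ** br z y.
pose z2 := e ** y - y ** e.
have z1k : z1 \in k by exact: mulC.
have z2k : z2 \in k by exact: mulC.
have solve := idem_solve br_lie br_2step J_complex gskt ea ek.
have [v1 v1k v1E] := solve _ z1k; have [v2 v2k v2E] := solve _ z2k.
pose u := v1 + br z v2.
have ua : u \in a by rewrite memvD ?br_a // ksub.
have uE : e ** u - u = (weight e (J (br z y)) - c * d) *: e.
  have -> : e ** u - u = z1 + br z z2.
    rewrite -v1E -v2E linearDr linearBr /= (adC _ _ (ksub v2k)).
    by rewrite opprD addrACA.
  rewrite /z1 /z2 linearBr /= (adC (J e)) // !weightE linearZr_LR /= weightE.
  by rewrite addrA subrK scalerBl scalerA mulrC.
apply/eqP; rewrite -subr_eq0; apply: contraT => c0.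
have /negP[] := root_notin_image (memvZ (weight e (J (br z y)) - c * d)^-1 ua).
by rewrite linearZr_LR -scalerBr uE scalerA mulVf // scale1r.
Qed.

Lemma weight_bracket_J z w :
  weight e (J (br (J z) (J w))) = weight e (J (br z w)).
Proof.
rewrite nijenhuis // linearD /= JJ weightD weightN.
by rewrite (weight_derv (memvD (br_a _ _) (br_a _ _))) oppr0 addr0.
Qed.

Lemma weight_J_bracket z w : weight e (J (br z w)) =
  weight e z * weight e (J w) - weight e w * weight e (J z).
Proof.
have phie u : weight e (J (br (J e) u)) = weight e (J u).
  rewrite -weight_bracket_J JJ linearNl -brC weight_J_bracket_derv //.
  by rewrite weight_J_root mulr1.
have /(congr1 (weight e \o J)) := jacobi br_lie (J e) z w.
rewrite /= phie linearD weightD [br (br _ _) w]brC linearN weightN /=.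
rewrite (weight_J_bracket_derv z (br_a _ _)).
rewrite (weight_J_bracket_derv w (br_a _ _)).
by rewrite !phie [RHS]addrC.
Qed.

End OneRoot.

Definition root_family (es : seq V) : Prop :=
  [/\ uniq es, {in es, forall e, is_root e} &
      {in es &, forall e e', e != e' -> e ** e' = 0}].

(* The common kernel of the weights of [es] and of their composites with [J]. *)
Definition root_kernel (es : seq V) : {vspace V} :=
  (\bigcap_(i < size es) (lker (linfun (applyr br es`_i)) :&:
     lker (linfun (applyr br es`_i) \o J)))%VS.

Lemma mem_root_kernel es x : x \in root_kernel es <->
  {in es, forall e, br x e = 0 /\ x ** e = 0}.
Proof.
split=> [xr e es_e|xr].
  have xe := index_mem e es; rewrite es_e in xe.
  move: xr; rewrite memvE => /subv_bigcapP/(_ (Ordinal xe) isT).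
  rewrite -memvE memv_cap !memv_ker comp_lfunE !lfunE /= nth_index //.
  by move=> /andP[/eqP ? /eqP ?].
rewrite memvE; apply/subv_bigcapP => i _; rewrite -memvE memv_cap !memv_ker.
rewrite comp_lfunE !lfunE /=; have [|-> ->] := xr es`_i; first exact: mem_nth.
by rewrite eqxx.
Qed.

Lemma derJ_root_kernel es : {subset es <= a} -> (k <= root_kernel es)%VS.
Proof.
move=> esa; apply/subvP => x xk; apply/mem_root_kernel => e /esa ea.
by rewrite ab0 ?kill // ksub.
Qed.

Lemma J_stable (U : {vspace V}) : (J @: (U + J @: U) <= U + J @: U)%VS.
Proof.
rewrite limgD subv_add addvSr; apply/sub_limgP => _ /memv_imgP[x xU ->].
by rewrite JJ (subvP (addvSl _ _)) ?memvN.
Qed.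

Section Family.
Variable es : seq V.
Hypothesis es_root : {in es, forall e, is_root e}.

Local Notation r := (root_kernel es).

Lemma root_kernel_J x : x \in r -> J x \in r.
Proof.
move/mem_root_kernel => xr; apply/mem_root_kernel => e /xr[xe Jxe].
by rewrite JJ linearNl /= xe oppr0.
Qed.

Lemma root_kernel_bracket z x : x \in r -> br z x \in r.
Proof.
move/mem_root_kernel => xr; apply/mem_root_kernel => e es_e.
have e_root := es_root es_e; have [ea e0 _ _] := e_root.
have [xe Jxe] := xr e es_e.
have wx y : br y e = 0 -> weight e y = 0.
  by move=> ye; apply: weight_eq; rewrite // scale0r.
rewrite ab0 // (weightE e_root) (weight_J_bracket e_root) (wx _ xe) (wx _ Jxe).
by rewrite mulr0 mul0r subrr scale0r.
Qed.

Lemma root_kernel_ideal : J_ideal br J fullv r.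
Proof.
split; first exact: subvf.
  by apply/brv_subP => x y _; exact: root_kernel_bracket.
by apply/sub_limgP => x; exact: root_kernel_J.
Qed.

(* For [y] in a [J]-invariant subspace, the value of [weight \o J] at [[Jy, y]]
   is a sum of two squares, so it survives along the [J]-derived series. *)
Lemma J_solvable_root_kernel (B : {vspace V}) :
  (J @: B <= B)%VS -> J_solvable br J B -> (B <= r)%VS.
Proof.
move=> JB [n Bn]; apply/subvP => y yB; apply/mem_root_kernel => e es_e.
have e_root := es_root es_e.
have noweight z : z \in B -> weight e (J z) = 0.
  elim: n B JB Bn {y yB} z => [|n IHn] B JB Bn z zB.
    move: zB; rewrite [B]Bn memv0 => /eqP ->.
    by rewrite linear0 /weight linear0l linear0.
  have JzB : J z \in B by exact: (elimT (sub_limgP _ _ _) JB).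
  have zz : z ** z \in J_derived br J B.
    by apply: (subvP (addvSl _ _)); apply: memv_brv.
  have := IHn (J_derived br J B); rewrite -iterSr.
  move=> /(_ (J_stable _) Bn _ zz)/eqP.
  rewrite (weight_J_bracket e_root) JJ weightN mulrN opprK.
  rewrite paddr_eq0 -?expr2 ?sqr_ge0 //.
  by case/andP; rewrite sqrf_eq0 => /eqP.
have JyB : J y \in B by exact: (elimT (sub_limgP _ _ _) JB).
have wy : weight e y = 0.
  by rewrite -[y]opprK -JJ noweight // linearN memvN.
by rewrite !(weightE e_root) wy noweight // scale0r.
Qed.

Definition root_chain (j : nat) : {vspace quoA br J} :=
  iter j (fun N => brv (@quoA_mul R V br J) N N)
    (quoA_pi br J @: (a :&: r))%VS.

Lemma root_chain_ideal j : alg_ideal (@quoA_mul R V br J) (root_chain j).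
Proof.
elim: j => [|j IHj] /=; last first.
  by apply: alg_ideal_brv => //; apply: quoA_mulA; eassumption.
move=> x _ /memv_imgP[z /memv_capP[za zr] ->].
rewrite -(quoA_valK x) [X in X \in _]quoA_pi_mul ?quoA_val //.
by apply/memv_img; rewrite memv_cap br_a root_kernel_bracket.
Qed.

Lemma root_chainS j : (root_chain j.+1 <= root_chain j)%VS.
Proof. by apply/brv_subP => x y _ yN; apply: root_chain_ideal. Qed.

Lemma root_chain_sub j : (root_chain j <= root_chain 0)%VS.
Proof. by elim: j => // j; apply: subv_trans (root_chainS j). Qed.

Lemma J_solvable_root_chain j :
  root_chain j = 0%VS -> J_solvable br J r.
Proof.
move=> Nj0.
pose U i : {vspace V} := (a :&: quoA_pi br J @^-1: root_chain i)%VS.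
pose S i := (U i + J @: U i)%VS.
have memU i x : (x \in U i) = (x \in a) && (quoA_pi br J x \in root_chain i).
  by rewrite memv_cap memv_preim.
have derS (A : {vspace V}) i :
    (brv br A A <= U i)%VS -> (J_derived br J A <= S i)%VS.
  by move=> AU; rewrite addvS // limgS.
have derM (A B : {vspace V}) :
    (A <= B)%VS -> (J_derived br J A <= J_derived br J B)%VS.
  by move=> AB; rewrite addvS ?limgS ?brvS.
have rS i : (iter i.+1 (J_derived br J) r <= S i)%VS.
  elim: i => [|i IHi].
    apply: derS; apply/brv_subP => x y xr yr; rewrite memU br_a.
    by apply/memv_img; rewrite memv_cap br_a root_kernel_bracket.
  apply: subv_trans (derM _ _ IHi) _; apply: derS.
  apply/brv_subP => _ _ /memv_addP[x xU [_ /memv_imgP[x' x'U ->] ->]]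
    /memv_addP[y yU [_ /memv_imgP[y' y'U ->] ->]].
  move: xU x'U yU y'U; rewrite !memU => /andP[xa xN] /andP[x'a x'N].
  move=> /andP[ya yN] /andP[y'a y'N]; rewrite br_a /=.
  have mulN u v : u \in a -> v \in a -> quoA_pi br J u \in root_chain i ->
      quoA_pi br J v \in root_chain i ->
      quoA_pi br J (u ** v) \in root_chain i.+1.
    by move=> ua va uN vN; rewrite -quoA_pi_mul //; apply: memv_brv.
  rewrite linearDl !linearDr /= ab0 // add0r !linearD /=.
  rewrite brC linearN /= memvD ?memvN ?mulN // memvD //; first exact: mulN.
  have /eqP -> : quoA_pi br J (br (J x') (J y')) == 0.
    rewrite quoA_pi_eq0 // mem_derJ // br_a nijenhuis // ab0 // add0r.
    by rewrite JJ memvN memvD.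
  exact: mem0v.
have Uk : (U j <= k)%VS.
  apply/subvP => x; rewrite memU Nj0 memv0 => /andP[xa].
  by rewrite quoA_pi_eq0.
have Sk : (S j <= k)%VS.
  rewrite subv_add Uk; apply/sub_limgP => x /(subvP Uk).
  exact: derJ_J.
exists j.+2; apply/eqP; rewrite -subv0.
apply: subv_trans (derM _ _ (rS j)) _.
have -> : J_derived br J (S j) = 0%VS; last exact: subvv.
suff S0 : brv br (S j) (S j) = 0%VS by rewrite /J_derived S0 limg0 addv0.
apply/eqP; rewrite -subv0; apply/brv_subP => x y /(subvP Sk)/ksub xa.
by move=> /(subvP Sk)/ksub ya; rewrite ab0 ?mem0v.
Qed.

End Family.

Lemma root_family_exists :
  exists es, root_family es /\ J_solvable br J (root_kernel es).
Proof.
suff ext n es : (\dim (a :&: root_kernel es) < n)%N -> root_family es ->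
    exists es', root_family es' /\ J_solvable br J (root_kernel es').
  by apply: (ext _ [::] (ltnSn _)).
elim: n es => // n IHn es dimn fam; have [uq root orth] := fam.
have [j Nj] : exists j, root_chain es j.+1 = root_chain es j.
  by apply: vspace_descending_stable => j; exact: root_chainS.
have [N0|N0] := eqVneq (root_chain es j) 0%VS.
  by exists es; split=> //; exact: J_solvable_root_chain N0.
have [e [ea e0 ee eN line]] := derv_idempotent_line br_lie br_2step J_complex
  gskt (@root_chain_ideal es root j) Nj N0.
have esa : {subset es <= a} by move=> e' /root[].
have er : e \in root_kernel es.
  have /memv_imgP[z /memv_capP[za zr] /eqP] :=
    subvP (root_chain_sub root j) _ eN.
  rewrite quoA_pi_eq // => ez; rewrite -(subrK z e) memvD //.
  exact: (subvP (derJ_root_kernel esa)).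
have ee' e' : e' \in es -> e ** e' = 0.
  by move/mem_root_kernel: er => /(_ e') h /h[].
have e'e e' : e' \in es -> e' ** e = 0.
  move=> es_e'; have e'a := esa _ es_e'.
  apply: (eigen_derJ br_lie br_2step J_complex gskt ea ee).
    by rewrite -[_ ** _]subr0 -(ee' _ es_e') mulC.
  by rewrite adC // ee.
apply: (IHn (e :: es)).
  rewrite -ltnS (leq_trans _ dimn) // ltnS.
  rewrite (ltn_leqif (dimv_leqif_sup _)).
    apply/negP => /subvP/(_ e); rewrite !memv_cap ea er => /(_ isT).
    move=> /mem_root_kernel/(_ e); rewrite inE eqxx => /(_ isT)[_ /eqP].
    by rewrite ee (negPf e0).
  apply: capvS => //; apply/subvP => x /mem_root_kernel xr.
  by apply/mem_root_kernel => e' es_e'; apply: xr; rewrite inE es_e' orbT.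
split=> [|e'|e1 e2].
- rewrite /= uq andbT; apply/negP => es_e.
  by have /eqP := ee' _ es_e; rewrite ee (negPf e0).
- by rewrite inE => /predU1P[->|/root].
- rewrite !inE => /predU1P[->|e1s] /predU1P[->|e2s]; rewrite ?eqxx //.
  + by move=> _; exact: ee'.
  + by move=> _; exact: e'e.
  + exact: orth.
Qed.

End Roots.
Section Splitting.
Variables (R : realType) (V : vectType R).
Variables (br : {bilinear V -> V -> V}) (J : 'End(V)) (g : {biscalar V}).
Hypothesis br_lie : lie_bracket br.
Hypothesis br_2step : two_step_solvable br.
Hypothesis J_complex : complex_structure br J.
Hypothesis gskt : SKT_metric br J g.
Variable es : seq V.
Hypothesis fam : root_family br J es.
Hypothesis r_solvable : J_solvable br J (root_kernel br J es).

Local Notation p := (size es).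
Local Notation r := (root_kernel br J es).

Definition roots_comb (x : affRs R p) : V :=
  \sum_(i < p) ((x i).1 *: es`_i + (x i).2 *: J es`_i).

Lemma roots_comb_linear : linear roots_comb.
Proof.
move=> c x y; rewrite /roots_comb scaler_sumr -big_split /=.
apply: eq_bigr => i _; rewrite !ffunE /= scalerDr !scalerA.
by rewrite !scalerDl addrACA.
Qed.

HB.instance Definition _ :=
  GRing.isLinear.Build R (affRs R p) V _ roots_comb roots_comb_linear.

Let es_root (i : 'I_p) : is_root br J es`_i.
Proof. by have [_ + _] := fam; apply; apply: mem_nth. Qed.

Let es_a (i : 'I_p) : es`_i \in derv br.
Proof. by have [] := es_root i. Qed.

Let br_e (i j : 'I_p) : br es`_i es`_j = 0.
Proof. exact: (derv_abelian br_2step). Qed.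

Let br_Je (i j : 'I_p) : br (J es`_i) es`_j = (i == j)%:R *: es`_j.
Proof.
have [uq _ orth] := fam; have [<-|ij] := eqVneq i j.
  by have [_ _ -> _] := es_root i; rewrite scale1r.
rewrite scale0r orth ?mem_nth //.
by rewrite (nth_uniq 0 _ _ uq) ?ltn_ord.
Qed.

Let br_JeJe (i j : 'I_p) : br (J es`_i) (J es`_j) = 0.
Proof.
rewrite nijenhuis // br_e add0r br_Je [br es`_i _](bracketC br_lie) br_Je.
rewrite eq_sym; have [->|] := eqVneq i j; first by rewrite subrr linear0.
by rewrite !scale0r subr0 linear0.
Qed.

Let sum_delta (j : 'I_p) (c : 'I_p -> R) (v : 'I_p -> V) :
  \sum_(i < p) c i *: ((i == j)%:R *: v i) = c j *: v j.
Proof.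
rewrite (bigD1 j) //= eqxx scale1r big1 ?addr0 // => i ij.
by rewrite (negPf ij) scale0r scaler0.
Qed.

Lemma J_roots_comb x : J (roots_comb x) = roots_comb (affRs_J x).
Proof.
rewrite linear_sum; apply: eq_bigr => i _; rewrite ffunE /= linearD !linearZ /=.
by rewrite (J_J J_complex) scalerN scaleNr addrC.
Qed.

Lemma bracket_comb_root x (j : 'I_p) :
  br (roots_comb x) es`_j = (x j).2 *: es`_j.
Proof.
rewrite linear_sumlz -(sum_delta j (fun i => (x i).2) (fun=> es`_j)) /=.
apply: eq_bigr => i _.
by rewrite linearDl !linearZl_LR /= br_e br_Je scaler0 add0r.
Qed.

Lemma bracket_comb_J_root x (j : 'I_p) :
  br (roots_comb x) (J es`_j) = - ((x j).1 *: es`_j).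
Proof.
rewrite linear_sumlz -(sum_delta j (fun i => (x i).1) (fun i => es`_i)) /=.
rewrite -sumrN; apply: eq_bigr => i _.
rewrite linearDl !linearZl_LR /= br_JeJe scaler0 addr0.
by rewrite (bracketC br_lie) br_Je eq_sym scalerN.
Qed.

Lemma bracket_roots_comb x y :
  br (roots_comb x) (roots_comb y) = roots_comb (affRs_br x y).
Proof.
rewrite {2}/roots_comb linear_sumr; apply: eq_bigr => j _.
rewrite linearD !linearZ /= bracket_comb_root bracket_comb_J_root ffunE /=.
by rewrite scalerN !scalerA -scalerBl scale0r addr0 mulrC [_ * (x j).1]mulrC.
Qed.

Lemma roots_comb_kernel x : roots_comb x \in r -> x = 0.
Proof.
move/mem_root_kernel => xr; apply/ffunP => j; rewrite ffunE.
have [] := xr es`_j (mem_nth 0 (ltn_ord j)); have [_ e0 _ _] := es_root j.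
rewrite J_roots_comb !bracket_comb_root ffunE /=.
move=> /eqP + /eqP; rewrite !scaler_eq0 (negPf e0) !orbF => /eqP x2 /eqP x1.
by case: (x j) x1 x2 => ? ? /= -> ->.
Qed.

Lemma roots_comb_compl z : exists x, z - roots_comb x \in r.
Proof.
exists [ffun i : 'I_p => (weight br es`_i (J z), weight br es`_i z)].
apply/mem_root_kernel => _ /(nthP 0)[j jp <-].
have wE := weightE br_lie br_2step (es_root (Ordinal jp)).
have bE x := bracket_comb_root x (Ordinal jp); rewrite /= in wE bE.
rewrite linearB !linearBl /= J_roots_comb !bE !ffunE /= !wE.
by rewrite !subrr.
Qed.

Lemma roots_comb_splitting :
  Rad_semidirect br J (limg (linfun roots_comb)) /\
  hol_iso br J (@affRs_br R p) (@affRs_J R p)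
    (limg (linfun roots_comb)) (linfun roots_comb).
Proof.
have mem_comb x : roots_comb x \in limg (linfun roots_comb).
  by have := memv_img (linfun roots_comb) (memvf x); rewrite lfunE.
have [_ root _] := fam.
split; last first.
  split=> [|//|x y|x]; rewrite ?lfunE /= ?bracket_roots_comb ?J_roots_comb //.
  apply/eqP; rewrite -subv0; apply/subvP => x; rewrite memv_ker memv0 lfunE /=.
  by move=> /eqP x0; apply/eqP/roots_comb_kernel; rewrite x0 mem0v.
split.
  split; last first.
    by apply/sub_limgP => _ /memv_imgP[x _ ->]; rewrite lfunE /= J_roots_comb.
  apply/brv_subP => _ _ /memv_imgP[x _ ->] /memv_imgP[y _ ->].
  by rewrite !lfunE /= bracket_roots_comb.
exists r; split.
- split=> [||B [_ _ JB]] //.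
    exact: (root_kernel_ideal br_lie br_2step J_complex gskt).
  exact: (J_solvable_root_kernel br_lie br_2step J_complex gskt).
- apply/vspaceP => z; rewrite memvf; have [x zr] := roots_comb_compl z.
  by rewrite -(subrK (roots_comb x) z) addrC memv_add.
- apply/eqP; rewrite -subv0; apply/subvP => z /memv_capP[].
  case/memv_imgP => x _ ->; rewrite lfunE /= => /roots_comb_kernel ->.
  by rewrite linear0 mem0v.
Qed.

End Splitting.
(** * The mean curvature vector *)

Section Trace.
Variables (R : realType) (V : vectType R).

Lemma tr_on_dual_basis (W : vectType R) (f : 'Hom(W, V)) (T : finType)
    (v : T -> W) (xi : T -> W -> R) (F : {linear V -> V}) (G : W -> W) :
  lker f = 0%VS -> (forall t, scalar (xi t)) ->
  (forall t t', xi t (v t') = (t' == t)%:R) ->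
  (forall w w', (forall t, xi t w = xi t w') -> w = w') ->
  (forall w, F (f w) = f (G w)) ->
  tr_on (limg f) F = \sum_t xi t (G (v t)).
Proof.
move=> kf xi_lin xi_v xi_inj FG; set H := limg f; set b := vbasis H.
have fK : cancel f (f^-1)%VF by apply: lker0_lfunK; rewrite kf.
pose X t : {scalar W} :=
  HB.pack_for {scalar W} (xi t)
    (GRing.isLinear.Build R W R *%R (xi t) (xi_lin t)).
have xiZ t c w : xi t (c *: w) = c * xi t w := scalarZ (X t) c w.
have xi_sum t (I : finType) (w : I -> W) :
    xi t (\sum_i w i) = \sum_i xi t (w i).
  exact: (linear_sum (X t)).
have wE w : w = \sum_t xi t w *: v t.
  apply: xi_inj => t; rewrite xi_sum (bigD1 t) //= xiZ xi_v eqxx mulr1.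
  by rewrite big1 ?addr0 // => t' /negPf tt'; rewrite xiZ xi_v tt' mulr0.
have bE (i : 'I_(\dim H)) : b`_i = f ((f^-1)%VF b`_i).
  by rewrite limg_lfunVK //; apply/vbasis_mem/memt_nth.
transitivity (\sum_(i < \dim H) \sum_t
    xi t ((f^-1)%VF b`_i) * coord b i (f (G (v t)))).
  apply: eq_bigr => i _; rewrite {1}bE {1}[(f^-1)%VF b`_i]wE !linear_sum.
  apply: eq_bigr => t _.
  by rewrite !linearZ /= FG.
rewrite exchange_big; apply: eq_bigr => t _ /=.
under eq_bigr => i _ do rewrite mulrC -xiZ.
rewrite -xi_sum; congr (xi t _).
under eq_bigr => i _ do rewrite -linearZ.
rewrite -linear_sum -[RHS]fK; congr ((f^-1)%VF _).
by rewrite -coord_vbasis // memv_img ?memvf.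
Qed.

Lemma tr_on_affs p q (f : 'Hom(affs R p q, V)) (F : {linear V -> V})
    (G1 : 'I_p -> affR R -> affR R) (G2 : 'I_q -> affC R -> affC R) :
  lker f = 0%VS ->
  (forall w, F (f w) =
    f ([ffun i => G1 i (w.1 i)], [ffun j => G2 j (w.2 j)])) ->
  tr_on (limg f) F =
  \sum_i ((G1 i (1, 0)).1 + (G1 i (0, 1)).2) +
  \sum_j ((G2 j ((1, 0), 0)).1.1 + (G2 j ((0, 1), 0)).1.2 +
          (G2 j (0, (1, 0))).2.1 + (G2 j (0, (0, 1))).2.2).
Proof.
move=> kf FG.
pose T := ('I_p * bool + 'I_q * (bool * bool))%type.
pose unit (b : bool) : affR R := if b then (0, 1) else (1, 0).
pose comp (b : bool) (x : affR R) : R := if b then x.2 else x.1.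
pose v (t : T) : affs R p q := match t with
  | inl (i, b) => ([ffun i' => if i' == i then unit b else 0], 0)
  | inr (j, (b, c)) => (0, [ffun j' => if j' == j then
       (if b then (0, unit c) else (unit c, 0)) else 0]) end.
pose xi (t : T) (w : affs R p q) : R := match t with
  | inl (i, b) => comp b (w.1 i)
  | inr (j, (b, c)) => comp c (if b then (w.2 j).2 else (w.2 j).1) end.
rewrite (tr_on_dual_basis (v := v) (xi := xi) kf _ _ _ FG).
- rewrite big_sumType /=; congr (_ + _).
    transitivity (\sum_i \sum_b comp b (G1 i (unit b))).
      by rewrite pair_bigA; apply: eq_bigr => -[i b] _ /=; rewrite !ffunE eqxx.
    by apply: eq_bigr => i _; rewrite big_bool /= addrC.
  transitivity (\sum_j \sum_bc xi (inr (j, bc))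
      ([ffun i => G1 i 0], [ffun j' => G2 j' ((v (inr (j, bc))).2 j')])).
    by rewrite pair_bigA; apply: eq_bigr => -[j [b c]] _ /=; rewrite !ffunE.
  apply: eq_bigr => j _; transitivity (\sum_b \sum_c
      comp c (if b then (G2 j (0, unit c)).2 else (G2 j (unit c, 0)).1)).
    rewrite pair_bigA; apply: eq_bigr => -[b c] _ /=; rewrite !ffunE eqxx.
    by case: b.
  by rewrite !big_bool /=; ring.
- have compP b : scalar (comp b) by case: b.
  case=> [[i b]|[j [b c]]] d x y; rewrite /xi.
    have -> : (d *: x + y).1 i = d *: x.1 i + y.1 i by rewrite linearP !ffunE.
    exact: compP.
  have -> : (d *: x + y).2 j = d *: x.2 j + y.2 j by rewrite linearP !ffunE.
  by case: b; exact: compP.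
- case=> [[i b]|[j [b c]]] [[i' b']|[j' [b' c']]]; rewrite /xi /v /= !ffunE.
  + rewrite -[inl _ == _]/((i', b') == (i, b)) xpair_eqE eq_sym.
    by case: (eqVneq i' i);  case: b b' => [] [] /=.
  + by case: b.
  + by case: b c => [] [].
  + rewrite -[inr _ == _]/((j', (b', c')) == (j, (b, c))) !xpair_eqE eq_sym.
    by case: (eqVneq j' j);  case: b c b' c' => [] [] [] [].
- case=> [w1 w2] [w1' w2'] eqw; congr (_, _); apply/ffunP => i.
    have := eqw (inl (i, false)); have := eqw (inl (i, true)).
    by rewrite /xi /=; case: (w1 i) (w1' i) => ? ? [? ?] /= -> ->.
  have := eqw (inr (i, (false, false))); have := eqw (inr (i, (false, true))).
  have := eqw (inr (i, (true, false))); have := eqw (inr (i, (true, true))).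
  rewrite /xi /=.
  by case: (w2 i) (w2' i) => [[? ?] [? ?]] [[? ?] [? ?]] /= -> -> -> ->.
Qed.

End Trace.

Section MeanCurvatureVector.
Variables (R : realType) (V : vectType R).
Variables (br : {bilinear V -> V -> V}) (J : 'End(V)).
Variables (p q : nat) (f : 'Hom(affs R p q, V)).
Hypothesis f_iso : hol_iso br J (@affs_br R p q) (@affs_J R p q) (limg f) f.

Let kf : lker f = 0%VS. Proof. by case: f_iso. Qed.
Let fbr x y : f (affs_br x y) = br (f x) (f y). Proof. by case: f_iso. Qed.
Let fJ x : f (affs_J x) = J (f x). Proof. by case: f_iso. Qed.

Lemma tr_ad_affs x :
  tr_on (limg f) (br (f x)) = \sum_i (x.1 i).2 + \sum_j 2 * (x.2 j).1.2.
Proof.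
rewrite (tr_on_affs (G1 := fun i => affR_br (x.1 i))
  (G2 := fun j => affC_br (x.2 j)) kf) => [|w]; last exact/esym/fbr.
by congr (_ + _); apply: eq_bigr => i _;
  rewrite /= /aff_det /= /aff_det /=; ring.
Qed.

Lemma killing_affs x y : killing br (limg f) (f x) (f y) =
  \sum_i (x.1 i).2 * (y.1 i).2 +
  \sum_j 2 * ((x.2 j).1.2 * (y.2 j).1.2 - (x.2 j).2.2 * (y.2 j).2.2).
Proof.
rewrite /killing -[fun z => _]/(br (f x) \o br (f y)).
rewrite (tr_on_affs (G1 := fun i => affR_br (x.1 i) \o affR_br (y.1 i))
  (G2 := fun j => affC_br (x.2 j) \o affC_br (y.2 j)) kf) => [|w]; last first.
  rewrite -[LHS]/(br (f x) (br (f y) (f w))) -!fbr; congr (f (_, _)).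
    by apply/ffunP => i; rewrite !ffunE.
  by apply/ffunP => i; rewrite !ffunE.
by congr (_ + _); apply: eq_bigr => i _;
  rewrite /= /aff_det /= /aff_det /=; ring.
Qed.

Lemma mean_curvature_coord s w :
  (forall x, s (f x) = f (affs_s x)) ->
  (forall x, x \in limg f -> tr_on (limg f) (br x) =
     killing11 br J (limg f) (f w) (s x)) ->
  w = ([ffun=> (0, 2)], [ffun=> ((0, 2), 0)]).
Proof.
move=> sf tr_eq.
have {tr_eq} eqn (u : affs R p q) : 0 =
    \sum_i ((w.1 i).1 * (u.1 i).1 + ((w.1 i).2 - 2) * (u.1 i).2) / 2 +
    \sum_j ((w.2 j).1.1 * (u.2 j).1.1 + ((w.2 j).1.2 - 2) * (u.2 j).1.2 +
            (w.2 j).2.1 * (u.2 j).2.1 + (w.2 j).2.2 * (u.2 j).2.2).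
  have := tr_eq _ (memv_img f (memvf u)).
  rewrite tr_ad_affs sf /killing11 -!fJ !killing_affs => eqn.
  move/esym/eqP: eqn; rewrite -subr_eq0 [_ + _ + (_ + _)]addrACA -!big_split.
  rewrite mulrDr !mulr_sumr opprD addrACA -!sumrB => /eqP eqn.
  rewrite -[LHS]eqn.
  by congr (_ + _); apply: eq_bigr => i _;
    rewrite /= !ffunE /= ?ffunE /=; field.
have sq0 (x y : R) : x ^+ 2 + y ^+ 2 = 0 -> x = 0 /\ y = 0.
  move/eqP; rewrite paddr_eq0 ?sqr_ge0 // !sqrf_eq0.
  by case/andP => /eqP -> /eqP ->.
have := eqn ([ffun i => ((w.1 i).1, (w.1 i).2 - 2)],
  [ffun j => (((w.2 j).1.1, (w.2 j).1.2 - 2), (w.2 j).2)]).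
set S1 := \sum_i _; set S2 := \sum_j _ => /esym/eqP.
have p1 i : true -> 0 <= ((w.1 i).1 ^+ 2 + ((w.1 i).2 - 2) ^+ 2) / 2.
  by rewrite divr_ge0 ?addr_ge0 ?sqr_ge0.
have p2 j : true -> 0 <= ((w.2 j).1.1 ^+ 2 + ((w.2 j).1.2 - 2) ^+ 2) +
    ((w.2 j).2.1 ^+ 2 + (w.2 j).2.2 ^+ 2).
  by rewrite !addr_ge0 ?sqr_ge0.
have -> : S1 = \sum_i ((w.1 i).1 ^+ 2 + ((w.1 i).2 - 2) ^+ 2) / 2.
  by apply: eq_bigr => i _; rewrite !ffunE.
have -> : S2 = \sum_j (((w.2 j).1.1 ^+ 2 + ((w.2 j).1.2 - 2) ^+ 2) +
    ((w.2 j).2.1 ^+ 2 + (w.2 j).2.2 ^+ 2)).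
  by apply: eq_bigr => i _; rewrite !ffunE /= !addrA.
rewrite paddr_eq0 ?sumr_ge0 //.
case/andP => /eqP/(psumr_eq0P p1) z1 /eqP/(psumr_eq0P p2) z2.
have {}z1 i : w.1 i = (0, 2).
  have /eqP := z1 i isT; rewrite mulf_eq0 invr_eq0 pnatr_eq0 orbF => /eqP/sq0[].
  by case: (w.1 i) => x y /= -> /eqP; rewrite subr_eq0 => /eqP ->.
have {}z2 j : w.2 j = ((0, 2), 0).
  have /eqP := z2 j isT; rewrite paddr_eq0 ?addr_ge0 ?sqr_ge0 //.
  case/andP => /eqP/sq0[+ +] /eqP/sq0[].
  case: (w.2 j) => [[x y] [z t]] /= -> /eqP.
  by rewrite subr_eq0 => /eqP -> -> ->.
clear -z1 z2; case: w z1 z2 => [w1 w2] /= z1 z2.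
by congr (_, _); apply/ffunP => i; rewrite ffunE.
Qed.

End MeanCurvatureVector.

Lemma mean_curvature_bracket (R : realType) (V : vectType R)
    (br : {bilinear V -> V -> V}) (J : 'End(V)) (H : {vspace V}) (JU : V) :
  is_mean_curvature br J H JU -> br JU (- J JU) = 2 *: (- J JU).
Proof.
case=> JUH [s [p [q [f [f_iso sf]]]] tr_eq].
have [_ fH fbr fJ] := f_iso; subst H.
have /memv_imgP[w _ JUw] := JUH; rewrite {}JUw in JUH tr_eq *.
rewrite (mean_curvature_coord f_iso sf tr_eq) -fJ -linearN -fbr -linearZ.
have affR_eq (x y : affR R) : x.1 = y.1 -> x.2 = y.2 -> x = y.
  by case: x y => ? ? [? ?] /= -> ->.
have affC_eq (x y : affC R) : x.1 = y.1 -> x.2 = y.2 -> x = y.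
  by case: x y => ? ? [? ?] /= -> ->.
have scaleE (x : R^o) : 2 *: x = 2 * x by [].
congr (f (_, _)); apply/ffunP => i; rewrite !ffunE /=.
  by apply: affR_eq; rewrite /= /aff_det /= scaleE; ring.
by apply: affC_eq; apply: affR_eq; rewrite /= /aff_det /= scaleE; ring.
Qed.

(** * The second cohomology *)

Section TwoCochains.
Variables (R : realType) (L M : vectType R).

Lemma cochain_upd0 n (c : {ffun 'I_n -> L} -> M) v i :
  cochain c -> c (upd v i 0) = 0.
Proof.
case=> lin _; have := lin v i 1 0 0.
by rewrite scaler0 addr0 scale1r => /eqP; rewrite -subr_eq subrr => /eqP.
Qed.

Lemma ce_d1 (br : L -> L -> L) (rho : L -> M -> M) (b : {ffun 'I_1 -> L} -> M)
    (v : {ffun 'I_2 -> L}) :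
  ce_d br rho b v = rho (v ord0) (b (tupf 1 [:: v ord_max])) -
    rho (v ord_max) (b (tupf 1 [:: v ord0])) -
    b (tupf 1 [:: br (v ord0) (v ord_max)]).
Proof.
rewrite /ce_d; under [X in _ + X]eq_bigr do rewrite big_mkcond.
rewrite !big_ord_recl !big_ord0 /= !addr0 !add0r.
have -> : lift ord0 ord0 = ord_max :> 'I_2 by apply: val_inj.
rewrite scale1r expr1 !scaleN1r.
by congr (rho _ (b _) - rho _ (b _) - b _); apply/ffunP => i;
  rewrite ord1 !ffunE -?val_eqE //=; congr (v _); apply: val_inj.
Qed.

Variable c : {ffun 'I_2 -> L} -> M.
Hypothesis c_cochain : cochain c.

Let c2 x y := c (tupf 2 [:: x; y]).

Let c2Pl a x x' y : c2 (a *: x + x') y = a *: c2 x y + c2 x' y.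
Proof.
have updE z : tupf 2 [:: z; y] = upd (tupf 2 [:: 0; y]) ord0 z.
  by apply/ffunP => -[[|[]]] //= lt; rewrite !ffunE.
by rewrite /c2 (updE (_ + _)) (updE x) (updE x'); case: c_cochain => ->.
Qed.

Let c2Pr a x y y' : c2 x (a *: y + y') = a *: c2 x y + c2 x y'.
Proof.
have updE z : tupf 2 [:: x; z] = upd (tupf 2 [:: x; 0]) ord_max z.
  by apply/ffunP => -[[|[]]] //= lt; rewrite !ffunE.
by rewrite /c2 (updE (_ + _)) (updE y) (updE y'); case: c_cochain => ->.
Qed.

Let c2xx x : c2 x x = 0.
Proof.
by case: c_cochain => _ /(_ _ ord0 ord_max); apply; rewrite // !ffunE.
Qed.

Lemma cochain2_plane (x y : L) (a b a' b' : R) (v : {ffun 'I_2 -> L}) :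
  v ord0 = a *: x + b *: y -> v ord_max = a' *: x + b' *: y ->
  c v = (a * b' - b * a') *: c (tupf 2 [:: x; y]).
Proof.
move=> v0 v1; have -> : v = tupf 2 [:: a *: x + b *: y; a' *: x + b' *: y].
  by apply/ffunP => -[[|[]]] //= lt; rewrite !ffunE /= -?v0 -?v1;
     congr (v _); apply: val_inj.
have c2yx : c2 y x = - c2 x y.
  apply/eqP; rewrite -addr_eq0; have /eqP := c2xx (1 *: x + y).
  by rewrite c2Pl !c2Pr !c2xx !scale1r add0r addr0 addrC.
have c2Zl d z w : c2 (d *: z) w = d *: c2 z w.
  have := c2Pl d z 0 w; rewrite addr0 => ->.
  by rewrite -[RHS]addr0; congr (_ + _); have := c2Pl (-1) w w w;
     rewrite scaleN1r addNr => ->; rewrite scaleN1r addNr.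
have c2Zr d z w : c2 z (d *: w) = d *: c2 z w.
  have := c2Pr d z w 0; rewrite addr0 => ->.
  by rewrite -[RHS]addr0; congr (_ + _); have := c2Pr (-1) z z z;
     rewrite scaleN1r addNr => ->; rewrite scaleN1r addNr.
rewrite -/(c2 _ _) c2Pl !c2Pr !c2Zl !c2Zr !c2xx c2yx !scaler0.
by rewrite add0r addr0 !scalerN !scalerA -scalerBl [b * _]mulrC.
Qed.

End TwoCochains.

Section QuotientFactor.
Variables (R : realType) (V : vectType R).
Variables (br : {bilinear V -> V -> V}) (J : 'End(V)).

Lemma quo_br_bilinear : bilinear_for *:%R *:%R (@quo_br R V br J).
Proof.
split=> x c y z; rewrite /quo_br; first by rewrite !linearP linearPl linearP.
by rewrite !linearP.
Qed.

HB.instance Definition _ := bilinear_isBilinear.Build R (quoJ br J) (quoJ br J)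
  (quoJ br J) _ _ (@quo_br R V br J) quo_br_bilinear.

Hypothesis br_lie : lie_bracket br.
Hypothesis br_2step : two_step_solvable br.
Hypothesis J_complex : complex_structure br J.
Variable g : {biscalar V}.
Hypothesis gskt : SKT_metric br J g.

Local Notation a := (derv br).
Local Notation k := (derJ br J).
Local Notation pi := (quo_pi br J).
Local Notation qbr := (@quo_br R V br J).
Local Notation qJ := (quo_J br J).

Lemma derv_OJ x : x \in a -> x \in OJ br J.
Proof.
move=> xa; apply/mem_OJ => y yk; have yJ := derJ_J J_complex yk.
by rewrite !(derv_abelian br_2step) ?linear0 // (derJ_sub J_complex).
Qed.

Lemma OJ_J x : x \in OJ br J -> J x \in OJ br J.
Proof.
move/mem_OJ => xO; apply/mem_OJ => y yk.
rewrite nijenhuis // linearD /= [X in _ + (_ + J X)]xO //.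
by rewrite (J_J J_complex) addrCA subrr addr0.
Qed.

Lemma mem_OJ_derJ x m : x \in OJ br J -> m \in k -> br x m \in k.
Proof.
by move=> /mem_OJ xO mk; rewrite (mem_derJ J_complex) -xO // !bracket_derv.
Qed.

Lemma quo_val_OJ (x : quoJ br J) : vsval x \in OJ br J.
Proof. by apply: (subvP (diffvSl (OJ br J) k)); apply: subvsP. Qed.

Lemma quo_val_derJ (x : quoJ br J) : vsval x \in k -> x = 0.
Proof.
move=> xk; apply: subvs_inj; apply/eqP; rewrite [vsval 0]linear0.
by rewrite -memv0 -(capv_diff (OJ br J) k) memv_cap subvsP.
Qed.

Lemma qbr_antisym x y : qbr x y = - qbr y x.
Proof. by rewrite /quo_br (bracketC br_lie) linearN. Qed.

Section MeanCurvatureLift.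
Variable JU : quoJ br J.
Hypothesis bracket_JU : qbr JU (- qJ JU) = 2 *: (- qJ JU).

Local Notation U := (- qJ JU).

Let A := vsval JU.
Let u := vsval U.
Let z := J A + u.

Let zk : z \in k.
Proof.
have uE : u = - vsval (pi (J A)).
  have -> : pi (J A) = qJ JU.
    by rewrite /quo_J 2![RHS]comp_lfunE [linfun vsval _]lfunE.
  by rewrite /u linearN.
by rewrite /z uE quo_piP // OJ_J // quo_val_OJ.
Qed.

Let brk : br A u - 2 *: u \in k.
Proof.
have -> : 2 *: u = vsval (pi (br A u)).
  by have /(congr1 vsval) := bracket_JU; rewrite linearZ.
by rewrite quo_piP // derv_OJ // bracket_derv.
Qed.

Let ua : u \in a.
Proof.
have -> : u = 2^-1 *: (br A u - (br A u - 2 *: u)).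
  by rewrite subKr scalerA mulVf ?scale1r // pnatr_eq0.
by rewrite memvZ // memvB ?bracket_derv // (derJ_sub J_complex).
Qed.

Let adA y : y \in a -> br (J u) y = br A y.
Proof.
move=> ya; have -> : u = z - J A by rewrite /z addrC addKr.
rewrite linearB /= (J_J J_complex) opprK linearDl /=.
by rewrite (mulJ_kill br_2step J_complex zk ya) add0r.
Qed.

Lemma tau_JU_solve w : w \in k -> exists2 v, v \in k & br A v - 2 *: v = w.
Proof.
move=> wk; pose e := 2^-1 *: u; have ea : e \in a by rewrite memvZ.
have ae y : y \in a -> br (J e) y = 2^-1 *: br A y.
  by move=> ya; rewrite linearZ linearZl_LR /= adA.
have ek : br (J e) e - e \in k.
  have -> : br (J e) e - e = 4^-1 *: (br A u - 2 *: u).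
    rewrite ae // linearZr_LR /= scalerA scalerBr scalerA /e.
    by congr (_ *: _ - _ *: _); field.
  exact: memvZ.
have [v vk vE] :=
  idem_solve br_lie br_2step J_complex gskt ea ek (memvZ 2^-1 wk).
exists v => //; apply: (scalerI (a := 2^-1)).
  by rewrite invr_eq0 pnatr_eq0.
rewrite -vE scalerBr scalerA mulVf ?pnatr_eq0 // scale1r ae //.
exact: derJ_sub vk.
Qed.

Lemma tau_JU_U m : m \in k -> br u m = 0.
Proof.
by move=> mk; rewrite (derv_abelian br_2step) // (derJ_sub J_complex).
Qed.

Lemma mean_curvature_U0 : U = 0 -> JU = 0.
Proof.
move=> U0; apply: quo_val_derJ; rewrite -memvN -(J_J J_complex) derJ_J //.
by move: zk; rewrite /z /u U0 [vsval 0]linear0 addr0.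
Qed.

Lemma mean_curvature_free : JU != 0 -> free [:: U; JU].
Proof.
move=> JU0; have U0 : U != 0 by apply: contraNneq JU0 => /mean_curvature_U0 ->.
rewrite free_cons seq1_free JU0 andbT span_seq1; apply/vlineP => -[d Ud].
have : qbr JU U = 0.
  by rewrite Ud linearZr_LR /= /quo_br (proj1 br_lie) linear0 scaler0.
by move/eqP; rewrite bracket_JU scaler_eq0 (negPf U0) pnatr_eq0.
Qed.

Lemma H2_JU_vanish : H2_JU_eq0 JU.
Proof.
move=> c c_cochain _.
have tauE (x : subvs_of (h_JU JU)) (m : subvs_of k) :
    vsval (tau_JU x m) = br (vsval (vsval x)) (vsval m).
  have xh := subvsP x; rewrite vsprojK //; apply: mem_OJ_derJ.
    exact: quo_val_OJ.
  exact: subvsP.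
have [JU0|JU0] := eqVneq JU 0.
  have all0 (x : subvs_of (h_JU JU)) : x = 0.
    apply: subvs_inj; apply/eqP; rewrite [vsval 0]linear0 -memv0.
    apply: (subvP _ _ (subvsP x)); apply/span_subvP => y.
    by rewrite JU0 linear0 oppr0 !inE orbb memv0.
  exists (fun=> 0); split; first by split=> *; rewrite ?scaler0 ?addr0.
  have tau0 (x : subvs_of (h_JU JU)) : tau_JU x 0 = 0 :> subvs_of k.
    by apply: subvs_inj; rewrite tauE [vsval 0]linear0 linear0r.
  move=> v; rewrite ce_d1 !tau0 !subr0.
  have -> : v = upd v ord0 0.
    by apply/ffunP => i; rewrite ffunE -(all0 (v i)); case: ifP.
  exact: cochain_upd0.
pose X := [tuple U; JU].
have X_free : free X by exact: mean_curvature_free.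
pose xi y := coord X ord0 y; pose eta y := coord X ord_max y.
have hE y : y \in h_JU JU -> y = xi y *: U + eta y *: JU.
  move=> yh; rewrite {1}[y](coord_span (X := X) yh).
  rewrite !big_ord_recl big_ord0 addr0.
  by congr (_ *: _ + coord X _ y *: _); apply: val_inj.
have Uh : U \in h_JU JU by rewrite memv_span ?inE ?eqxx.
have JUh : JU \in h_JU JU by rewrite memv_span ?inE ?eqxx ?orbT.
pose U' := vsproj (h_JU JU) U; pose JU' := vsproj (h_JU JU) JU.
have hE' (x : subvs_of (h_JU JU)) :
    x = xi (vsval x) *: U' + eta (vsval x) *: JU'.
  apply: subvs_inj; rewrite linearD !linearZ /= !vsprojK //.
  exact/hE/subvsP.
pose w := c (tupf 2 [:: U'; JU']).
have wk : - vsval w \in k by rewrite memvN; exact: subvsP.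
have [m mk mE] := tau_JU_solve wk.
exists (fun v => xi (vsval (v ord0)) *: vsproj k m); split.
  split=> [v i d x y|v i j]; last by rewrite !ord1 eqxx.
  rewrite !ffunE !ord1 eqxx /xi.
  have -> : vsval (d *: x + y) = d *: vsval x + vsval y by [].
  by rewrite linearP scalerDl scalerA.
move=> v; rewrite ce_d1.
rewrite (cochain2_plane c_cochain (hE' (v ord0)) (hE' (v ord_max))).
rewrite !ffunE /= -/w.
set x0 := xi _; set y0 := eta _; set x1 := xi _; set y1 := eta _.
apply: subvs_inj; rewrite !linearB !linearZ /= !tauE !linearZ /= vsprojK //.
have adm (x : subvs_of (h_JU JU)) :
    br (vsval (vsval x)) m = eta (vsval x) *: br A m.
  have /(congr1 vsval) -> := hE _ (subvsP x).
  have -> y : vsval (xi y *: U + eta y *: JU) = xi y *: u + eta y *: A by [].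
  by rewrite linearDl !linearZl_LR /= tau_JU_U // scaler0 add0r.
pose d := y1 * x1 - x0 * y0.
have -> : xi (vsval (sub_br (quo_br (J:=J)) (v ord0) (v ord_max))) = d * 2.
  have qE : qbr (vsval (v ord0)) (vsval (v ord_max)) = d * 2 *: U.
    have qxx y : qbr y y = 0 by rewrite /quo_br (proj1 br_lie) linear0.
    rewrite (hE _ (subvsP (v ord0))) (hE _ (subvsP (v ord_max))).
    rewrite -/x0 -/y0 -/x1 -/y1 linearDl !linearDr !linearZl_LR /=.
    rewrite !linearZr_LR /= !qxx [qbr U JU]qbr_antisym bracket_JU.
    move: (- qJ JU) => Uq.
    rewrite !scaler0 add0r addr0 !scalerN !scalerA -scaleNr -scalerDl /d.
    by congr (_ *: _); ring.
  rewrite /sub_br qE vsprojK ?memvZ // /xi linearZ /=.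
  by rewrite (coord_free ord0 ord0 X_free) [LHS]mulr1.
rewrite !adm -/y0 -/y1 scalerN scalerA scalerN scalerA.
have -> : vsval w = - (br A m - 2 *: m) by rewrite mE opprK.
rewrite scalerN scalerBr scalerA -scalerBl.
rewrite -scaleNr mulrC.
rewrite opprD -!scaleNr.
by congr (_ *: _ + _ *: _); rewrite /d; ring.
Qed.

End MeanCurvatureLift.

End QuotientFactor.

Theorem theorem4p13 (R : realType) (V : vectType R)
    (br : {bilinear V -> V -> V}) (J : 'End(V))
    (br_lie : lie_bracket br)
    (br_2step : two_step_solvable br)
    (J_complex : complex_structure br J)
    (J_SKT : exists g : {biscalar V}, SKT_metric br J g) :
  (forall (h : {vspace quoJ br J}) (JU : quoJ br J),
     quo_factor h ->
     is_mean_curvature (@quo_br R V br J) (quo_J br J) h JU ->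
     H2_JU_eq0 JU) /\
  (exists (p : nat) (H : {vspace V}) (f : 'Hom(affRs R p, V)),
     Rad_semidirect br J H /\
     hol_iso br J (@affRs_br R p) (@affRs_J R p) H f).
Proof.
have [g gskt] := J_SKT; split.
  move=> h JU _ JU_mean; apply: (H2_JU_vanish br_lie br_2step J_complex gskt).
  exact: mean_curvature_bracket JU_mean.
have [es [fam r_solvable]] := root_family_exists br_lie br_2step J_complex gskt.
exists (size es), (limg (linfun (@roots_comb R V J es))).
exists (linfun (@roots_comb R V J es)).
exact: (roots_comb_splitting br_lie br_2step J_complex gskt fam r_solvable).
Qed.
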